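(* Let $f$ be a Rademacher random multiplicative function and let $\mathcal{M}(x)=\sum_{n\leq x}f(n)$. Then, almost surely, $\mathcal{M}(x)$ changes sign infinitely often as $x\to\infty$.
   Context: A Rademacher random multiplicative function is defined as follows: $(f(p))_{p\text{ prime}}$ are independent random variables, each taking the values $+1$ and $-1$ with probability $1/2$; $f$ is extended to the positive integers by setting $f(1)=1$, $f(n)=\prod_{p\mid n}f(p)$ if $n$ is squarefree, and $f(n)=0$ if $n$ is not squarefree. A real function $M(x)$ is said to change sign infinitely often as $x\to\infty$ if neither of the statements ''$M(x)\geq 0$ for all sufficiently large $x$'' nor ''$M(x)\leq 0$ for all sufficiently large $x$'' holds. *)

(* Defs.v *)
From HB Require Import structures.
From mathcomp Require Import all_boot all_order all_algebra finmap.
From mathcomp Require Import all_classical all_reals all_analysis.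

Set Implicit Arguments.
Unset Strict Implicit.
Unset Printing Implicit Defensive.

Import Order.TTheory GRing.Theory Num.Theory.
Import numFieldNormedType.Exports.

Local Open Scope classical_set_scope.
Local Open Scope ring_scope.

Section independence.
Context d (T : measurableType d) (R : realType) (P : probability T R).

Definition independent_RVs (I : choiceType) (D : set I)
    (X : I -> {RV P >-> R}) : Prop :=
  forall (A : {fset I}) (B : I -> set R),
    (forall i, i \in A -> D i) ->
    (forall i, i \in A -> measurable (B i)) ->
    P (\bigcap_(i in [set` A]) (X i @^-1` B i)) =
    (\prod_(i <- A) P (X i @^-1` B i))%E.

End independence.

(* 0 is not squarefree (take d = 0). *)
Definition squarefree (n : nat) : Prop :=
  forall d : nat, (d ^ 2 %| n)%N -> d = 1%N.

Section rademacher.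
Context d (T : measurableType d) (R : realType) (P : probability T R).

(* The value f 0 is left unconstrained: only positive integers matter. *)
Record rademacher_rmf (f : nat -> {RV P >-> R}) : Prop := RademacherRMF {
  rademacher_indep : independent_RVs [set p | prime p] f ;
  rademacher_pos : forall p, prime p -> P (f p @^-1` [set 1]) = (2^-1)%:E ;
  rademacher_neg : forall p, prime p -> P (f p @^-1` [set -1]) = (2^-1)%:E ;
  rademacher_one : forall w, f 1%N w = 1 ;
  rademacher_squarefree : forall n w, (0 < n)%N -> squarefree n ->
    f n w = \prod_(p <- primes n) f p w ;
  rademacher_nonsquarefree : forall n w, (0 < n)%N -> ~ squarefree n ->
    f n w = 0
}.

End rademacher.

(* The positive integers n <= x are those with 1 <= n <= Num.truncn x, also
   when x < 1, as then Num.truncn x = 0. *)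
Definition summatory (R : realType) (a : nat -> R) (x : R) : R :=
  \sum_(1 <= n < (Num.truncn x).+1) a n.

Definition changes_sign_infinitely_often (R : realType) (M : R -> R) : Prop :=
  ~ (\forall x \near +oo, 0 <= M x) /\ ~ (\forall x \near +oo, M x <= 0).

(* Main.v *)
(* Write M for the partial sums of f, N_n for the number of primes in (n/2, n],
   and F(s) for the sum of f(n) n^(-s), which is the product of the
   1 + f(p) p^(-s).  Two facts about the sum of |M(n)| n^(-3/2) contradict each
   other if M has a constant sign from x0 on.

   It diverges almost surely.  A prime in (n/2, n] enters M(n) only through
   f(p), so a fourth moment bound, conditionally on the other f(p), shows that
   |M(n)| >= sqrt(N_n) / 2 >= N_n / (2 sqrt n) with probability at least 3/32;
   and the sum of N_n / n^2 diverges because that of 1/p does.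

   It is bounded in terms of x0 if M has a constant sign from x0 on: by partial
   summation F(s) is the sum of the M(n) (n^(-s) - (n+1)^(-s)), so for s > 1/2
   the sum of the |M(n)| (n^(-s) - (n+1)^(-s)) is at most |F(s)| plus a constant,
   while F(s) <= 1 with probability tending to 1 as s decreases to 1/2, because
   E sqrt(F(s)) is at most the product of the 1 - p^(-2s) / 8.

   Everything is carried out for finitely many primes and n <= N; F(s) becomes a
   finite product, at mean square distance sum_(n > N) n^(-2s) from the partial
   sum up to N of the Dirichlet series. *)
Require Import Defs.
From mathcomp Require Import all_boot all_order all_algebra finmap.
From mathcomp Require Import all_classical all_reals all_analysis.
From mathcomp Require Import ring lra zify.

Set Implicit Arguments.
Unset Strict Implicit.
Unset Printing Implicit Defensive.

Import Order.TTheory GRing.Theory Num.Theory.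
Import numFieldNormedType.Exports.

Local Open Scope classical_set_scope.
Local Open Scope ring_scope.

(** * Squarefree numbers and products over primes *)

Lemma squarefree_gt0 n : squarefree n -> (0 < n)%N.
Proof. by case: n => // /(_ 0%N (dvdnn 0)). Qed.

Lemma squarefree1 : squarefree 1.
Proof. by move=> d; rewrite dvdn1; case: d => [|[|d]]. Qed.

Lemma squarefree_mulp p n : prime p ->
  squarefree (p * n) <-> squarefree n /\ ~~ (p %| n)%N.
Proof.
move=> pp; split=> [sqpn|[sqn npn] d d2].
  split=> [d dn|]; first by apply: sqpn; rewrite dvdn_mull.
  apply/negP => pn; have := sqpn p.
  by rewrite expnS expn1 dvdn_mul // => /(_ isT) p1; rewrite p1 in pp.
have npd : coprime d p.
  rewrite coprime_sym prime_coprime //; apply: contra npn => pd.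
  rewrite -(@dvdn_pmul2l p) ?prime_gt0 //; apply: dvdn_trans d2.
  by rewrite expnS expn1 dvdn_mul.
by apply: sqn; rewrite Gauss_dvdr ?coprimeXl // in d2.
Qed.

Lemma squarefree_prime p : prime p -> squarefree p.
Proof.
move=> pp; rewrite -[p]muln1; apply/squarefree_mulp => //.
by split; [exact: squarefree1 | rewrite dvdn1 gtn_eqF ?prime_gt1].
Qed.

Lemma primes_mulp p n : prime p -> (0 < n)%N -> ~~ (p %| n)%N ->
  perm_eq (primes (p * n)) (p :: primes n).
Proof.
move=> pp n0 npn; apply: uniq_perm; rewrite ?primes_uniq //=.
  by rewrite primes_uniq mem_primes pp n0 npn.
by move=> q; rewrite primesM ?(prime_gt0 pp) // primes_prime // !inE.
Qed.

(** The products of the sublists of [s]: for distinct primes, the squarefree numbers indexing the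
    expansion of an Euler product over [s]. *)
Fixpoint sqf_products (s : seq nat) : seq nat :=
  if s is p :: t then sqf_products t ++ map (muln p) (sqf_products t)
  else [:: 1%N].

Lemma mem_sqf_products (s : seq nat) n : all prime s -> uniq s ->
  n \in sqf_products s <-> squarefree n /\ {subset primes n <= s}.
Proof.
elim: s n => [|p s IH] n /=.
  move=> _ _; rewrite inE; split=> [/eqP->|[/squarefree_gt0 n0 sub]].
    by split=> //; exact: squarefree1.
  have : primes n = [::] by case: (primes n) sub => // a l /(_ a); rewrite inE eqxx => /(_ isT).
  by move/eqP; rewrite primes_eq0; case: n n0 {sub} => [|[|n]].
move=> /andP[pp ps] /andP[pns us]; rewrite mem_cat; split.
  case/orP=> [/(IH _ ps us)[sq sub]|/mapP[m /(IH _ ps us)[sq sub] ->]].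
    by split=> // q /sub; rewrite inE => ->; rewrite orbT.
  have npm : ~~ (p %| m)%N.
    apply: contra pns => pm; apply: sub.
    by rewrite mem_primes pp pm squarefree_gt0.
  split; first by apply/squarefree_mulp.
  move=> q; rewrite (perm_mem (primes_mulp pp (squarefree_gt0 sq) npm)) !inE.
  by case/orP=> [->//|/sub ->]; rewrite orbT.
move=> [sq sub]; have n0 := squarefree_gt0 sq; apply/orP.
case: (boolP (p %| n)%N) => [/dvdnP[m nE]|npn]; last first.
  left; apply/(IH _ ps us); split=> // q qn; have := sub q qn.
  rewrite inE => /orP[/eqP qp|//]; move: qn.
  by rewrite qp mem_primes (negPf npn) !andbF.
right; rewrite mulnC in nE; rewrite nE in sq n0 sub *; apply: map_f.
have [sqm npm] := (squarefree_mulp m pp).1 sq.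
apply/(IH _ ps us); split=> // q qm.
have := sub q; rewrite (perm_mem (primes_mulp pp (squarefree_gt0 sqm) npm)).
rewrite !inE qm orbT => /(_ isT) /orP[/eqP qp|//].
by move: qm; rewrite qp mem_primes (negPf npm) !andbF.
Qed.

Lemma uniq_sqf_products (s : seq nat) : all prime s -> uniq s ->
  uniq (sqf_products s).
Proof.
elim: s => //= p s IH /andP[pp ps] /andP[pns us].
have us' := IH ps us.
rewrite cat_uniq us' /= map_inj_uniq ?us' ?andbT; last first.
  by move=> a b /eqP; rewrite eqn_pmul2l ?prime_gt0 // => /eqP.
apply/hasPn => _ /mapP[m mS ->]; apply/negP => /(mem_sqf_products _ ps us)[sq sub].
case/negP: pns; apply: sub; rewrite mem_primes pp dvdn_mulr //.
by rewrite squarefree_gt0.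
Qed.

Lemma prod_sqf_products (R : comNzRingType) (x : nat -> R) (s : seq nat) :
  all prime s -> uniq s ->
  \prod_(p <- s) (1 + x p) = \sum_(n <- sqf_products s) \prod_(q <- primes n) x q.
Proof.
elim: s => [|p s IH] /=; first by rewrite big_nil big_seq1 big_nil.
move=> /andP[pp ps] /andP[pns us].
rewrite big_cons IH // mulrDl mul1r big_cat /= big_map; congr (_ + _).
rewrite mulr_sumr; apply: eq_big_seq => m /(mem_sqf_products _ ps us)[sq sub].
have npm : ~~ (p %| m)%N.
  by apply: contra pns => pm; apply: sub; rewrite mem_primes pp pm squarefree_gt0.
by rewrite (perm_big _ (primes_mulp pp (squarefree_gt0 sq) npm)) big_cons.
Qed.

Lemma squarefree_prod_primes n : squarefree n ->
  (\prod_(q <- primes n) q)%N = n.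
Proof.
elim/ltn_ind: n => n IH sq; have n0 := squarefree_gt0 sq.
case: (ltnP 1 n) => [n1|]; last by case: n n0 {IH sq} => [|[|n]] //; rewrite big_nil.
have pp := pdiv_prime n1; have /dvdnP[m nE] := pdiv_dvd n.
move: (pdiv n) pp nE => p pp nE; rewrite mulnC in nE; rewrite nE in sq n0 *.
have [sqm npm] := (squarefree_mulp m pp).1 sq.
rewrite (perm_big _ (primes_mulp pp (squarefree_gt0 sqm) npm)) big_cons IH //.
by rewrite nE ltn_Pmull ?prime_gt1 ?squarefree_gt0.
Qed.

(** Divide out squares [d ^ 2] with [d] different from 1 until none is left. *)
Lemma squarefree_decomp n : (0 < n)%N ->
  exists m k, [/\ squarefree m, (0 < k)%N & n = (m * k ^ 2)%N].
Proof.
elim/ltn_ind: n => n IH n0.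
have [sq|nsq] := pselect (squarefree n); first by exists n, 1%N; split; rewrite ?muln1.
have [d] : exists d, ~ ((d ^ 2 %| n)%N -> d = 1%N) by apply/existsNP.
move=> /not_implyP[/dvdnP[n' nE] d1].
have d0 : (0 < d)%N by case: d nE d1 => // nE; rewrite nE muln0 in n0.
have n'0 : (0 < n')%N by case: n' nE => // nE; rewrite nE in n0.
have [|m [k [sqm k0 n'E]]] := IH n' _ n'0.
  rewrite nE ltn_Pmulr // -(exp1n 2) ltn_exp2r //.
  by move: d0 d1; case: d {nE} => [|[|d]].
exists m, (k * d)%N; split=> //; first by rewrite muln_gt0 k0.
by rewrite nE n'E expnMn mulnA.
Qed.

Definition primes_below (Z : nat) : seq nat := [seq p <- iota 0 Z | prime p].

Lemma mem_primes_below Z p : (p \in primes_below Z) = prime p && (p < Z)%N.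
Proof. by rewrite mem_filter mem_iota add0n. Qed.

Lemma uniq_primes_below Z : uniq (primes_below Z).
Proof. by rewrite filter_uniq ?iota_uniq. Qed.

Lemma all_primes_below Z : all prime (primes_below Z).
Proof. by apply/allP => p; rewrite mem_primes_below => /andP[]. Qed.

(** The prime factors of a number up to [N] are themselves at most [N], so no squarefree number up
    to [N] is missing from the expanded product. *)
Lemma sum_sqf_products_le (R : nmodType) N (F : nat -> R) :
  \sum_(n <- sqf_products (primes_below N.+1) | (n <= N)%N) F n =
  \sum_(1 <= n < N.+1 | `[< squarefree n >]) F n.
Proof.
rewrite -big_filter -[RHS]big_filter; apply: perm_big.
have u := uniq_primes_below N.+1; have a := all_primes_below N.+1.
apply: uniq_perm; rewrite ?filter_uniq ?uniq_sqf_products ?iota_uniq // => n.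
rewrite !mem_filter mem_index_iota ltnS; apply/andP/andP.
  move=> [nN /(mem_sqf_products _ a u)[sq sub]].
  by split; [exact/asboolP | rewrite nN squarefree_gt0].
move=> [/asboolP sq /andP[n0 nN]]; split=> //.
apply/(mem_sqf_products _ a u); split=> // q; rewrite mem_primes mem_primes_below.
by move=> /and3P[-> _ qn]; rewrite /= ltnS (leq_trans (dvdn_leq n0 qn)).
Qed.

Lemma squarefree_prod_mult (R : comNzRingType) (h : nat -> R) n :
  h 1%N = 1 -> {morph h : m k / (m * k)%N >-> m * k} -> squarefree n ->
  \prod_(q <- primes n) h q = h n.
Proof.
move=> h1 hM sq; rewrite -[in RHS](squarefree_prod_primes sq).
by rewrite (big_morph h hM h1).
Qed.

(** * Divergence of the sum of the reciprocals of the primes *)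

Lemma sum_invsq_le (R : realFieldType) N :
  \sum_(1 <= k < N.+1) (k%:R ^+ 2)^-1 <= 2 :> R.
Proof.
(* The stronger bound passes through the induction because [1 / (a + 1) ^ 2 <= 1 / (a * (a + 1)) = 1
   / a - 1 / (a + 1)], which needs [a] nonzero. *)
suff: N = 0%N \/ \sum_(1 <= k < N.+1) (k%:R ^+ 2)^-1 <= 2 - (N%:R)^-1 :> R.
  case=> [->|]; first by rewrite big_geq.
  by move/le_trans; apply; rewrite gerBl invr_ge0.
elim: N => [|N IH]; [by left | right].
case: IH => [->|IH]; first by rewrite big_nat1 expr1n invr1; lra.
case: N IH => [|N] IH; first by rewrite big_nat1 expr1n invr1; lra.
rewrite big_nat_recr //=; apply: le_trans (lerD IH (lexx _)) _.
have n0 : (0 : R) < N.+1%:R by rewrite ltr0Sn.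
rewrite -[N.+2%:R]natr1; move: (N.+1%:R : R) n0 => a a0.
have -> : 2 - (a + 1)^-1 = 2 - a^-1 + (a * (a + 1))^-1.
  by field; rewrite !gt_eqF //; lra.
by rewrite lerD2l lef_pV2 ?posrE ?exprn_gt0 ?mulr_gt0 //; nra.
Qed.

Lemma harmonic_unbounded (R : realType) (K : R) :
  exists N, K <= \sum_(1 <= n < N.+1) n%:R^-1.
Proof.
have nd : {homo series (@harmonic R) : n m / (n <= m)%N >-> n <= m}.
  by apply: nondecreasing_series => n _ _; rewrite /= invr_ge0.
have /cvgryPge/(_ K) := nondecreasing_dvgn_lt nd (@dvg_harmonic R).
case=> N _ /(_ N (leqnn N)) /= KN; exists N; apply: le_trans KN _.
by rewrite seriesEnat /= big_add1.
Qed.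

(* Writing n = m k^2 with m squarefree bounds the harmonic sum by twice
   its squarefree part, which the product of the 1 + 1/p dominates. *)
Lemma harmonic_le_expR_sum_primes (R : realType) N :
  \sum_(1 <= n < N.+1) n%:R^-1 <=
  2 * expR (\sum_(p <- primes_below N.+1) p%:R^-1) :> R.
Proof.
pose Sq := \sum_(1 <= m < N.+1 | `[< squarefree m >]) m%:R^-1 : R.
have SqE : Sq <= expR (\sum_(p <- primes_below N.+1) p%:R^-1).
  have -> : expR (\sum_(p <- primes_below N.+1) p%:R^-1) =
            \prod_(p <- primes_below N.+1) expR (p%:R^-1 : R).
    exact: (big_morph _ (@expRD R) (@expR0 R)).
  apply: (@le_trans _ _ (\prod_(p <- primes_below N.+1) (1 + p%:R^-1))); last first.
    apply: ler_prod => p _; rewrite expR_ge1Dx andbT.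
    by rewrite addr_ge0 // invr_ge0.
  rewrite prod_sqf_products ?all_primes_below ?uniq_primes_below //.
  rewrite /Sq -sum_sqf_products_le big_mkcond /= big_seq [leRHS]big_seq.
  apply: ler_sum => n nS.
  have [sq _] := (mem_sqf_products n (all_primes_below _) (uniq_primes_below _)).1 nS.
  rewrite (@squarefree_prod_mult _ (fun n => n%:R^-1)) ?invr1 //; last first.
    by move=> a b; rewrite natrM invfM.
  by case: ifP => // _; rewrite invr_ge0.
apply: (@le_trans _ _ (2 * Sq)); last by rewrite ler_pM2l.
(* Each [n] has at least one pair [(m, k)], and each pair has at most one [n]; the first fact bounds
   the sum from above, the second serves after the exchange of sums. *)
apply: (@le_trans _ _ (\sum_(1 <= n < N.+1)
   \sum_(1 <= m < N.+1 | `[< squarefree m >]) \sum_(1 <= k < N.+1)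
      if n == (m * k ^ 2)%N then n%:R^-1 else 0)).
  rewrite big_nat [leRHS]big_nat; apply: ler_sum => n /andP[n0 nN].
  have [m [k [sq k0 nE]]] := squarefree_decomp n0.
  have mN : (m < N.+1)%N.
    by apply: leq_ltn_trans nN; rewrite nE leq_pmulr ?expn_gt0 ?k0.
  have kN : (k < N.+1)%N.
    apply: leq_ltn_trans nN; rewrite nE expnS expn1 mulnA mulnC leq_pmulr //.
    by rewrite muln_gt0 squarefree_gt0.
  have ge0 (a b : nat) : 0 <= (if n == (a * b ^ 2)%N then n%:R^-1 else 0) :> R.
    by case: ifP => // _; rewrite invr_ge0.
  rewrite big_mkcond (bigD1_seq m) ?iota_uniq ?mem_index_iota ?squarefree_gt0 //=.
  rewrite (asboolT sq) (bigD1_seq k) ?iota_uniq ?mem_index_iota ?k0 //=.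
  rewrite -nE eqxx -addrA lerDl addr_ge0 ?sumr_ge0 // => i _.
  by case: ifP => // _; rewrite sumr_ge0.
rewrite exchange_big /= /Sq mulr_sumr.
apply: ler_sum => m _; rewrite exchange_big /=.
apply: (@le_trans _ _ (\sum_(1 <= k < N.+1) m%:R^-1 * (k%:R ^+ 2)^-1)).
  apply: ler_sum => k _; rewrite -big_mkcond /=.
  rewrite (eq_bigr (fun _ => m%:R^-1 * (k%:R ^+ 2)^-1)); last first.
    by move=> n /eqP ->; rewrite natrM natrX invfM.
  rewrite big_const_seq iter_addr_0.
  have : (count (eq_op^~ (m * k ^ 2)%N) (index_iota 1 N.+1) <= 1)%N.
    by rewrite (count_uniq_mem _ (iota_uniq _ _)) leq_b1.
  case: (count _ _) => [|[|c]] // _.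
    by rewrite mulr0n divr_ge0 ?invr_ge0 ?exprn_ge0.
rewrite -mulr_sumr mulrC ler_wpM2r ?invr_ge0 //; exact: sum_invsq_le.
Qed.

Lemma sum_inv_primes_unbounded (R : realType) (K : R) :
  exists N, K <= \sum_(p <- primes_below N.+1) p%:R^-1.
Proof.
have [N HN] := harmonic_unbounded (2 * expR K); exists N.
have := le_trans HN (harmonic_le_expR_sum_primes R N).
by rewrite ler_pM2l // ler_expR.
Qed.

(** * Averaging over signs *)

Section sign_average.
Context {R : realType}.
Implicit Types (x y : nat -> R) (A B : pred nat) (Phi Psi : (nat -> R) -> R).

Definition signs x := forall p, x p = 1 \/ x p = -1.

Definition flip A x : nat -> R := fun p => if A p then - x p else x p.

Lemma signs_flip A x : signs x -> signs (flip A x).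
Proof.
move=> sx p; rewrite /flip; case: (A p) => //.
by case: (sx p) => ->; [right | left; rewrite opprK].
Qed.

Lemma flip_flip A B x : flip A (flip B x) = flip [pred p | A p (+) B p] x.
Proof.
apply/funext => p; rewrite /flip /=.
by case: (A p); case: (B p) => //=; rewrite opprK.
Qed.

Lemma flipC A B x : flip A (flip B x) = flip B (flip A x).
Proof. by rewrite !flip_flip; apply/funext => p; rewrite /flip /= addbC. Qed.

Lemma flipK A : involutive (flip A).
Proof. by move=> x; rewrite flip_flip; apply/funext => p; rewrite /flip /= addbb. Qed.

(* The expectation of [Phi] when the coordinates below [k] are independent fair
   signs and the others are those of [x]. *)
Fixpoint avg (k : nat) Phi x : R :=
  if k is j.+1 then (avg j Phi x + avg j Phi (flip (pred1 j) x)) / 2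
  else Phi x.

Lemma avg_le k Phi Psi x : signs x -> (forall y, signs y -> Phi y <= Psi y) ->
  avg k Phi x <= avg k Psi x.
Proof.
move=> + le; elim: k x => [|k IH] x sx /=; first exact: le.
by rewrite ler_pM2r ?invr_gt0 // lerD // IH //; exact: signs_flip.
Qed.

Lemma eq_avg k Phi Psi x : signs x -> (forall y, signs y -> Phi y = Psi y) ->
  avg k Phi x = avg k Psi x.
Proof. by move=> sx e; apply/le_anti; rewrite !avg_le // => y /e ->. Qed.

Lemma avgD k Phi Psi x :
  avg k (fun y => Phi y + Psi y) x = avg k Phi x + avg k Psi x.
Proof. by elim: k x => [|k IH] x //=; rewrite !IH; field. Qed.

Lemma avgZ k c Phi x : avg k (fun y => c * Phi y) x = c * avg k Phi x.
Proof. by elim: k x => [|k IH] x //=; rewrite !IH; field. Qed.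

Lemma avg_cst k c x : avg k (fun=> c) x = c.
Proof. by elim: k x => [|k IH] x //=; rewrite !IH; field. Qed.

Lemma avg_sum k (I : Type) (r : seq I) (Q : pred I) (F : I -> (nat -> R) -> R) x :
  avg k (fun y => \sum_(i <- r | Q i) F i y) x = \sum_(i <- r | Q i) avg k (F i) x.
Proof.
elim: r => [|i r IH].
  rewrite big_nil -[RHS](avg_cst k 0 x); congr avg.
  by apply/funext => y; rewrite big_nil.
rewrite big_cons -IH.
case: ifP => Qi.
  by rewrite -avgD; congr avg; apply/funext => y; rewrite big_cons Qi.
by congr avg; apply/funext => y; rewrite big_cons Qi.
Qed.

Lemma avg_ge0 k Phi x : signs x -> (forall y, signs y -> 0 <= Phi y) ->
  0 <= avg k Phi x.
Proof. by move=> sx p; rewrite -(avg_cst k 0 x); apply: avg_le. Qed.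

Lemma avg_comp_flip k A Phi x :
  avg k (fun y => Phi (flip A y)) x = avg k Phi (flip A x).
Proof. by elim: k x => [|k IH] x //=; rewrite !IH flipC. Qed.

(** Flipping a coordinate below [k] only exchanges the two halves of the mean taken at that
    coordinate. *)
Lemma avg_flip_arg k A Phi x : (forall p, A p -> (p < k)%N) ->
  avg k Phi (flip A x) = avg k Phi x.
Proof.
elim: k A x => [|k IH] A x Ak /=.
  by congr Phi; apply/funext => p; rewrite /flip; case: ifP => // /Ak.
pose A' := [pred p | A p && (p != k)].
have A'k p : A' p -> (p < k)%N.
  by move=> /andP[/Ak]; rewrite ltnS leq_eqVlt => /orP[->|].
have [Ak'|nAk] := boolP (A k).
  have -> : flip A x = flip A' (flip (pred1 k) x).
    rewrite flip_flip; apply/funext => p; rewrite /flip /A' /=.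
    by have [->|] := eqVneq p k; rewrite ?Ak' ?andbT ?addbF.
  by rewrite (flipC (pred1 k)) flipK !(IH A') // addrC.
have -> : A = A'.
  apply/funext => p; rewrite /A' /=; have [->|] := eqVneq p k; last by rewrite andbT.
  by rewrite andbF (negPf nAk).
by rewrite (flipC (pred1 k)) !(IH A').
Qed.

Lemma avg_flip k A Phi x : (forall p, A p -> (p < k)%N) ->
  avg k (fun y => Phi (flip A y)) x = avg k Phi x.
Proof. by move=> Ak; rewrite avg_comp_flip avg_flip_arg. Qed.

Lemma avg_odd k p Phi x : signs x -> (p < k)%N ->
  (forall y, signs y -> Phi (flip (pred1 p) y) = - Phi y) -> avg k Phi x = 0.
Proof.
move=> sx pk odd; have : avg k Phi x = - avg k Phi x; last by lra.
rewrite -{1}(@avg_flip _ (pred1 p)); last by move=> q /eqP ->.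
by rewrite -mulN1r -avgZ; apply: eq_avg => // y sy; rewrite odd // mulN1r.
Qed.

Lemma avg_stable k l Phi x : (k <= l)%N ->
  (forall j y, (k <= j)%N -> Phi (flip (pred1 j) y) = Phi y) ->
  avg l Phi x = avg k Phi x.
Proof.
move=> kl st; elim: l kl => [|l IH]; first by rewrite leqn0 => /eqP ->.
rewrite leq_eqVlt => /orP[/eqP->//|]; rewrite ltnS => kl /=.
rewrite -avg_comp_flip IH //.
have -> : (fun y => Phi (flip (pred1 l) y)) = Phi by apply/funext => y; apply: st.
by rewrite IH //; field.
Qed.

(** Averages of [ind] play the role of probabilities in the finite model. *)
Definition ind (Q : Prop) : R := (`[< Q >])%:R.

Lemma ind_ge0 Q : 0 <= ind Q. Proof. exact: ler0n. Qed.

Lemma ind_le1 Q : ind Q <= 1. Proof. by rewrite lern1 leq_b1. Qed.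

Lemma indT (Q : Prop) : Q -> ind Q = 1. Proof. by rewrite /ind => /asboolT ->. Qed.

Lemma indF (Q : Prop) : ~ Q -> ind Q = 0. Proof. by rewrite /ind => /asboolF ->. Qed.

Lemma ind_le (Q1 Q2 : Prop) : (Q1 -> Q2) -> ind Q1 <= ind Q2.
Proof.
move=> h; have [q|q] := pselect Q1; last by rewrite indF // ind_ge0.
by rewrite (indT q) (indT (h q)).
Qed.

End sign_average.

(** * Bounds for the Dirichlet series *)

Lemma ler_sum_subset (R : numDomainType) (I : eqType) (s t : seq I) (F : I -> R) :
  uniq s -> uniq t -> {subset s <= t} -> (forall i, i \in t -> 0 <= F i) ->
  \sum_(i <- s) F i <= \sum_(i <- t) F i.
Proof.
move=> us ut st F0.
have e : perm_eq s [seq i <- t | i \in s].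
  apply: uniq_perm; rewrite ?filter_uniq // => i; rewrite mem_filter.
  by case: (boolP (i \in s)) => // /st ->.
rewrite (perm_big _ e) big_filter [leRHS](bigID (mem s)) /= lerDl big_seq_cond.
by rewrite sumr_ge0 // => i /andP[/F0].
Qed.

(** * The multiplicative function of a choice of signs, and its orthogonality *)

Section model.
Context {R : realType}.
Implicit Types (x y h : nat -> R).

Definition rmf x (n : nat) : R :=
  if `[< squarefree n >] then \prod_(p <- primes n) x p else 0.

Definition msum x (n : nat) : R := \sum_(1 <= k < n.+1) rmf x k.

Lemma msumS x n : msum x n.+1 = msum x n + rmf x n.+1.
Proof. by rewrite /msum big_nat_recr. Qed.

Lemma rmf_flip_id (A : pred nat) x n : (forall p, p \in primes n -> ~~ A p) ->
  rmf (flip A x) n = rmf x n.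
Proof.
move=> nA; rewrite /rmf; case: ifP => // _.
by apply: eq_big_seq => p /nA; rewrite /flip => /negPf ->.
Qed.

Lemma rmf_flip_odd p x n : p \in primes n ->
  rmf (flip (pred1 p) x) n = - rmf x n.
Proof.
move=> pn; rewrite /rmf; case: ifP => [_|]; last by rewrite oppr0.
rewrite !(bigD1_seq p) ?primes_uniq //= {1}/flip /= eqxx mulNr; congr (- (_ * _)).
by apply: eq_bigr => q; rewrite /flip /= => /negPf ->.
Qed.

Lemma rmf_sqr x n : signs x -> squarefree n -> rmf x n ^+ 2 = 1.
Proof.
move=> sx sq; rewrite /rmf asboolT // -prodrXl big1 // => p _.
by case: (sx p) => ->; rewrite ?sqrrN expr1n.
Qed.

Lemma normr_rmf x n : signs x -> `|rmf x n| <= 1.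
Proof.
move=> sx; rewrite -(@expr_le1 _ 2) // real_normK ?num_real //.
have [sq|nsq] := pselect (squarefree n); first by rewrite rmf_sqr.
by rewrite /rmf asboolF // expr0n.
Qed.

Lemma normr_msum x n : signs x -> `|msum x n| <= n%:R.
Proof.
move=> sx; apply: le_trans (ler_norm_sum _ _ _) _.
apply: (@le_trans _ _ (\sum_(1 <= k < n.+1) 1)).
  by apply: ler_sum => k _; exact: normr_rmf.
by rewrite big_const_nat iter_addr_0 subn1.
Qed.

Lemma msum_flip_id (A : pred nat) x n :
  (forall p, prime p -> (p <= n)%N -> ~~ A p) -> msum (flip A x) n = msum x n.
Proof.
move=> nA; apply: eq_big_nat => k /andP[k0 kn]; apply: rmf_flip_id => p.
rewrite mem_primes => /and3P[pp _ pk]; apply: nA => //.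
by rewrite -ltnS; apply: leq_ltn_trans kn; exact: dvdn_leq.
Qed.

Lemma squarefree_primes_inj n m : squarefree n -> squarefree m ->
  primes n =i primes m -> n = m.
Proof.
move=> sn sm e; rewrite -(squarefree_prod_primes sn) -(squarefree_prod_primes sm).
by apply: perm_big; apply: uniq_perm; rewrite ?primes_uniq.
Qed.

(** Some prime divides exactly one of [n] and [m], and the product is odd in the sign at that
    prime. *)
Lemma avg_rmf_orth k x n m : signs x -> squarefree n -> squarefree m -> n != m ->
  (forall p, p \in primes n -> (p < k)%N) -> (forall p, p \in primes m -> (p < k)%N) ->
  avg k (fun y => rmf y n * rmf y m) x = 0.
Proof.
move=> sx sn sm nm nk mk.
have [p] : exists p, (p \in primes n) != (p \in primes m).
  apply: contrapT => /forallNP e; move/eqP: nm; apply.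
  by apply: squarefree_primes_inj => // p; apply/eqP/negPn/negP/e.
have [pn|pn] := boolP (p \in primes n); have [pm|pm] := boolP (p \in primes m) => // _.
  apply: (avg_odd sx (nk _ pn)) => y _; rewrite rmf_flip_odd // rmf_flip_id ?mulNr //.
  by move=> q qm; apply: contra pm => /eqP <-.
apply: (avg_odd sx (mk _ pm)) => y _; rewrite mulrC rmf_flip_odd // rmf_flip_id ?mulNr //.
  by rewrite mulrC.
by move=> q qm; apply: contra pn => /eqP <-.
Qed.

Lemma avg_sqr_sum_rmf k x h (S : seq nat) : signs x -> uniq S ->
  (forall n, n \in S -> squarefree n) ->
  (forall n p, n \in S -> p \in primes n -> (p < k)%N) ->
  avg k (fun y => (\sum_(n <- S) rmf y n * h n) ^+ 2) x = \sum_(n <- S) h n ^+ 2.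
Proof.
move=> sx uS sqS Sk.
transitivity (\sum_(n <- S) \sum_(m <- S)
    h n * h m * avg k (fun y => rmf y n * rmf y m) x).
  transitivity (avg k (fun y => \sum_(n <- S) \sum_(m <- S)
      h n * h m * (rmf y n * rmf y m)) x).
    apply: eq_avg => // y _; rewrite expr2 mulr_suml; apply: eq_bigr => n _.
    by rewrite mulr_sumr; apply: eq_bigr => m _; ring.
  rewrite avg_sum; apply: eq_bigr => n _; rewrite avg_sum.
  by apply: eq_bigr => m _; rewrite avgZ.
apply: eq_big_seq => n nS; rewrite (bigD1_seq n) //= big1_seq ?addr0.
  rewrite -[RHS]mulr1 expr2; congr (_ * _); rewrite -[RHS](avg_cst k 1 x).
  by apply: eq_avg => // y sy; rewrite -expr2 rmf_sqr //; exact: sqS.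
move=> m /andP[mn mS]; rewrite avg_rmf_orth ?mulr0 1?eq_sym //; try exact: sqS.
- by move=> p; exact: Sk.
- by move=> p; exact: Sk.
Qed.

(** Independence of the signs: symmetrizing at [p] replaces the factor of [p] by its mean and leaves
    the others unchanged. *)
Lemma avg_prod k x (s : seq nat) (g : nat -> R -> R) : signs x -> uniq s ->
  (forall p, p \in s -> (p < k)%N) ->
  avg k (fun y => \prod_(p <- s) g p (y p)) x = \prod_(p <- s) ((g p 1 + g p (-1)) / 2).
Proof.
move=> sx; elim: s => [|p s IH] /=.
  move=> _ _; rewrite big_nil -[RHS](avg_cst k 1 x).
  by apply: eq_avg => // y _; rewrite big_nil.
move=> /andP[ps us] sk; rewrite big_cons -IH //; last first.
  by move=> q qs; apply: sk; rewrite inE qs orbT.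
rewrite -avgZ; set Psi := (fun y => _ * _).
pose Phi y := \prod_(q <- p :: s) g q (y q).
have fl : avg k (fun y => Phi (flip (pred1 p) y)) x = avg k Phi x.
  by apply: avg_flip => q /eqP ->; apply: sk; rewrite inE eqxx.
suff : avg k Phi x + avg k (fun y => Phi (flip (pred1 p) y)) x = 2 * avg k Psi x.
  by rewrite fl; change (avg k Phi x + avg k Phi x = 2 * avg k Psi x ->
    avg k Phi x = avg k Psi x); lra.
rewrite -avgD -avgZ; apply: eq_avg => // y sy; rewrite /Phi /Psi !big_cons.
have -> : \prod_(q <- s) g q (flip (pred1 p) y q) = \prod_(q <- s) g q (y q).
  apply: eq_big_seq => q qs; rewrite /flip /=; case: eqP => // qp.
  by rewrite -qp qs in ps.
by rewrite /flip /= eqxx; case: (sy p) => ->; rewrite ?opprK; field.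
Qed.

(** * Finite Euler products and Dirichlet sums for a nonincreasing multiplicative weight *)

Section weights.
Variable h : nat -> R.
Hypothesis h0 : forall n, 0 <= h n.
Hypothesis h_noninc : forall n, (0 < n)%N -> h n.+1 <= h n.
Hypothesis h1 : h 1%N = 1.
Hypothesis hM : {morph h : m n / (m * n)%N >-> m * n}.

Let h_le1 n : (0 < n)%N -> h n <= 1.
Proof.
case: n => // n _; elim: n => [|n IH]; first by rewrite h1.
by apply: le_trans IH; apply: h_noninc.
Qed.

Definition eprod N x : R := \prod_(p <- primes_below N.+1) (1 + x p * h p).

Definition eprod_tail N x : R :=
  \sum_(n <- sqf_products (primes_below N.+1) | (N < n)%N) rmf x n * h n.

Lemma eprod_expand N x :
  eprod N x = \sum_(1 <= n < N.+1) rmf x n * h n + eprod_tail N x.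
Proof.
have a := all_primes_below N.+1; have u := uniq_primes_below N.+1.
rewrite /eprod (@prod_sqf_products _ (fun p => x p * h p)) //.
transitivity (\sum_(n <- sqf_products (primes_below N.+1)) rmf x n * h n).
  apply: eq_big_seq => n /(mem_sqf_products _ a u)[sq _].
  by rewrite /rmf asboolT // big_split /= (squarefree_prod_mult h1 hM sq).
rewrite (bigID (fun n => (n <= N)%N)) /= sum_sqf_products_le; congr (_ + _).
  rewrite big_mkcond /=; apply: eq_bigr => n _; rewrite /rmf.
  by case: `[< squarefree n >]; rewrite ?mul0r.
by rewrite /eprod_tail; apply: eq_bigl => n; rewrite ltnNge.
Qed.

(** By orthogonality the mean square is the sum of the [h n ^+ 2] over the finitely many indices of
    the tail, all of which lie in an interval starting at [N.+1]. *)
Lemma avg_eprod_tail_sqr N x (tau : R) : signs x ->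
  (forall B, \sum_(N.+1 <= n < B) h n ^+ 2 <= tau) ->
  avg N.+1 (fun y => eprod_tail N y ^+ 2) x <= tau.
Proof.
move=> sx htau; have a := all_primes_below N.+1; have u := uniq_primes_below N.+1.
pose S := [seq n <- sqf_products (primes_below N.+1) | (N < n)%N].
have SE y : eprod_tail N y = \sum_(n <- S) rmf y n * h n by rewrite big_filter.
rewrite (@eq_avg _ _ _ (fun y => (\sum_(n <- S) rmf y n * h n) ^+ 2)) //; last first.
  by move=> y _; rewrite SE.
rewrite avg_sqr_sum_rmf //; last 3 first.
- by rewrite filter_uniq ?uniq_sqf_products.
- by move=> n; rewrite mem_filter => /andP[_ /(mem_sqf_products _ a u)[]].
- move=> n p; rewrite mem_filter => /andP[_ /(mem_sqf_products _ a u)[_ sub]] /sub.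
  by rewrite mem_primes_below => /andP[].
apply: le_trans (htau (\max_(n <- S) n).+1).
apply: ler_sum_subset => [|||n _]; rewrite ?sqr_ge0 ?iota_uniq //.
  by rewrite filter_uniq ?uniq_sqf_products.
move=> n nS; rewrite mem_index_iota ltnS leq_bigmax_seq // andbT.
by move: nS; rewrite mem_filter => /andP[].
Qed.

(* [g] is a cubic polynomial with [1 + y <= g y ^+ 2] whose mean over the two
   signs of [y] is only [1 - y ^+ 2 / 8]: it replaces [Num.sqrt (1 + y)]. *)
Lemma avg_eprod_gt1 N x : signs x ->
  avg N.+1 (fun y => ind (1 < eprod N y)) x <=
  expR (- (\sum_(p <- primes_below N.+1) h p ^+ 2) / 8).
Proof.
move=> sx; pose g (t : R) := 1 + t / 2 - t ^+ 2 / 8 + t ^+ 3 / 16.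
have g_sqr t : 1 + t <= g t ^+ 2.
  rewrite -subr_ge0; have -> : g t ^+ 2 - (1 + t) =
     (t ^+ 2 * (t - 2) / 16) ^+ 2 + (t ^+ 2 / 4) ^+ 2 by rewrite /g; field.
  by rewrite addr_ge0 ?sqr_ge0.
have hy y p : signs y -> p \in primes_below N.+1 -> `|y p * h p| <= 1.
  move=> sy; rewrite mem_primes_below => /andP[/prime_gt0 p0 _].
  by case: (sy p) => ->; rewrite ?mul1r ?mulN1r ?normrN ger0_norm // h_le1.
have g_ge0 t : `|t| <= 1 -> 0 <= g t.
  rewrite ler_norml => /andP[t1 t2]; rewrite /g.
  have : t ^+ 2 <= 1 by nra.
  have : -1 <= t ^+ 3 by nra.
  by lra.
(* Markov's inequality: the product of the [g] is nonnegative, and its square is at least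
   [eprod N y], so it is at least 1 on the event. *)
apply: (@le_trans _ _ (avg N.+1 (fun y => \prod_(p <- primes_below N.+1) g (y p * h p)) x)).
  apply: avg_le => // y sy.
  have g0 : 0 <= \prod_(p <- primes_below N.+1) g (y p * h p).
    by rewrite big_seq prodr_ge0 // => p pN; apply/g_ge0/hy.
  have [E1|?] := pselect (1 < eprod N y); last by rewrite indF.
  rewrite indT // -(@ler_sqr _ 1) ?nnegrE // expr1n; apply: ltW.
  apply: lt_le_trans E1 _; rewrite -prodrXl /eprod big_seq [leRHS]big_seq.
  apply: ler_prod => p pN; rewrite g_sqr andbT.
  by have := hy y p sy pN; rewrite ler_norml => /andP[]; lra.
rewrite (@avg_prod _ _ _ (fun p t => g (t * h p))) ?uniq_primes_below //; last first.
  by move=> p; rewrite mem_primes_below => /andP[].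
rewrite -sumrN mulr_suml.
rewrite (big_morph _ (@expRD R) (@expR0 R)) big_seq [leRHS]big_seq; apply: ler_prod => p.
rewrite mem_primes_below => /andP[/prime_gt0 p0 _].
have -> : (g (1 * h p) + g (-1 * h p)) / 2 = 1 + - h p ^+ 2 / 8 by rewrite /g; field.
rewrite expR_ge1Dx andbT.
have hp0 := h0 p; have hp1 := h_le1 p0.
by nra.
Qed.

(** The Euler product is nonnegative. If it is at most 1 while the Dirichlet sum exceeds 2 in
    absolute value, then [eprod_tail] exceeds 1 in absolute value, and Chebyshev's inequality
    applies. *)
Lemma avg_dsum_gt2 N x (tau : R) : signs x ->
  (forall B, \sum_(N.+1 <= n < B) h n ^+ 2 <= tau) ->
  avg N.+1 (fun y => ind (2 < `|\sum_(1 <= n < N.+1) rmf y n * h n|)) x <=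
  expR (- (\sum_(p <- primes_below N.+1) h p ^+ 2) / 8) + tau.
Proof.
move=> sx htau; apply: le_trans (lerD (avg_eprod_gt1 N sx) (avg_eprod_tail_sqr sx htau)).
rewrite -avgD; apply: avg_le => // y sy.
have [A2|?] := pselect (2 < `|\sum_(1 <= n < N.+1) rmf y n * h n|); last first.
  by rewrite indF // addr_ge0 ?sqr_ge0 ?ind_ge0.
rewrite indT //; have [E1|/negP] := pselect (1 < eprod N y).
  by rewrite indT // lerDl sqr_ge0.
rewrite -leNgt => E1; rewrite indF ?add0r; last by apply/negP; rewrite -leNgt.
have E0 : 0 <= eprod N y.
  rewrite /eprod big_seq prodr_ge0 // => p; rewrite mem_primes_below => /andP[/prime_gt0 p0 _].
  by have := h0 p; have := h_le1 p0; case: (sy p) => ->; lra.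
rewrite -[leLHS](expr1n _ 2) -(@real_normK _ (eprod_tail N y)) ?num_real //.
rewrite ler_pXn2r ?nnegrE //.
have -> : eprod_tail N y = eprod N y - \sum_(1 <= n < N.+1) rmf y n * h n.
  by rewrite eprod_expand addrAC subrr add0r.
rewrite distrC; apply: le_trans (lerB_dist _ _); rewrite (ger0_norm E0).
by lra.
Qed.

Lemma dsum_abel N x :
  \sum_(1 <= n < N.+1) rmf x n * h n =
  \sum_(1 <= n < N) msum x n * (h n - h n.+1) + msum x N * h N.
Proof.
elim: N => [|N IH]; first by rewrite /msum !big_geq // mul0r add0r.
rewrite big_nat_recr //= IH; case: N {IH} => [|N].
  by rewrite /msum big_nat1 !big_geq // !mul0r !add0r.
by rewrite [in RHS]big_nat_recr //= [msum x N.+2]msumS; ring.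
Qed.

(** With a constant sign [s], [dsum_abel] turns the sum of absolute values into [s] times the
    Dirichlet sum, up to an error from the indices below [x0]. *)
Lemma sum_normr_msum_le x (x0 X N : nat) : signs x -> (x0 <= N)%N -> (X < N)%N ->
  `|\sum_(1 <= n < N.+1) rmf x n * h n| <= 2 ->
  (forall n, (x0 <= n <= N)%N -> 0 <= msum x n) \/
  (forall n, (x0 <= n <= N)%N -> msum x n <= 0) ->
  \sum_(1 <= n < X.+1) `|msum x n| * (h n - h n.+1) <= 2 + 2 * x0%:R ^+ 2.
Proof.
move=> sx x0N XN A2 Q.
have [s [s1 Hs]] : exists s : R, (s = 1 \/ s = -1) /\
    forall n, (x0 <= n <= N)%N -> `|msum x n| = s * msum x n.
  case: Q => Q; [exists 1 | exists (-1)]; split; [by left| |by right|] => n /Q m0.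
    by rewrite ger0_norm ?mul1r.
  by rewrite ler0_norm ?mulN1r.
(* The cost of replacing [|msum x n|] by [s * msum x n]: below [x0] it is at most [2 * |msum x n|],
   and [|msum x n| <= n]. The weights being at most 1, the total cost is [2 * x0 ^ 2]. *)
pose e n : R := if (n < x0)%N then 2 * x0%:R else 0.
have He n : (n <= N)%N -> `|msum x n| <= s * msum x n + e n.
  move=> nN; rewrite /e; case: ltnP => nx0; last by rewrite addr0 Hs // nx0.
  have mb : `|msum x n| <= x0%:R.
    by apply: le_trans (normr_msum n sx) _; rewrite ler_nat ltnW.
  have : - `|msum x n| <= s * msum x n; last by lra.
  have := lerNnormlW (lexx `|msum x n|); have := ler_norm (msum x n).
  by case: s1 => ->; lra.
have wge0 n : (0 < n)%N -> 0 <= h n - h n.+1 by move=> n0; rewrite subr_ge0 h_noninc.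
have wle1 n : (0 < n)%N -> h n - h n.+1 <= 1.
  by move=> n0; have := h_le1 n0; have := h0 n.+1; lra.
apply: (@le_trans _ _ (\sum_(1 <= n < N) `|msum x n| * (h n - h n.+1) + `|msum x N| * h N)).
  rewrite [X in _ <= X + _](@big_cat_nat _ _ _ X.+1) //= -addrA lerDl.
  rewrite addr_ge0 ?mulr_ge0 // big_nat sumr_ge0 // => n /andP[Xn _].
  by rewrite mulr_ge0 // wge0 // (leq_trans _ Xn).
apply: (@le_trans _ _ (s * (\sum_(1 <= n < N.+1) rmf x n * h n) + \sum_(1 <= n < N) e n)).
  rewrite dsum_abel mulrDr addrAC; apply: lerD; last first.
    by rewrite mulrA Hs ?x0N ?leqnn.
  rewrite mulr_sumr -big_split /= big_nat [leRHS]big_nat; apply: ler_sum => n /andP[n0 nN].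
  have en0 : 0 <= e n by rewrite /e; case: ifP => // _; rewrite mulr_ge0.
  apply: le_trans (ler_wpM2r (wge0 n n0) (He n (ltnW nN))) _.
  by rewrite mulrDl mulrA lerD2l ler_piMr ?wle1.
apply: lerD.
  by move: A2; rewrite ler_norml => /andP[]; case: s1 => ->; lra.
apply: (@le_trans _ _ (\sum_(0 <= n < x0) (2 * x0%:R))).
  rewrite /e -big_mkcond -big_filter /=; apply: ler_sum_subset => [|||n _].
  - by rewrite filter_uniq ?iota_uniq.
  - exact: iota_uniq.
  - by move=> n; rewrite mem_filter !mem_index_iota => /andP[-> _].
  - by rewrite mulr_ge0.
by rewrite big_const_nat iter_addr_0 subn0 -[leLHS]mulr_natr expr2 mulrA.
Qed.

End weights.
End model.

(** * The weights of the Dirichlet series near the exponent 1/2 *)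

Section dirichlet_weight.
Context {R : realType}.
Variable eta : R.
Hypothesis eta0 : 0 < eta.

(** This is [n ^ -(1/2 + eta)], with the dependence on [eta] isolated in the second factor. *)
Definition dweight (n : nat) : R := (Num.sqrt n%:R)^-1 * (n%:R `^ eta)^-1.

Lemma dweight_ge0 n : 0 <= dweight n.
Proof. by rewrite mulr_ge0 ?invr_ge0 ?sqrtr_ge0 ?powR_ge0. Qed.

Lemma dweight1 : dweight 1%N = 1.
Proof. by rewrite /dweight sqrtr1 powR1 invr1 mulr1. Qed.

Lemma dweightM : {morph dweight : m n / (m * n)%N >-> m * n}.
Proof.
by move=> m n; rewrite /dweight natrM sqrtrM // powRM // !invfM mulrACA.
Qed.

Lemma natr_powR_le m n : (m <= n)%N -> m%:R `^ eta <= n%:R `^ eta :> R.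
Proof. by move=> mn; rewrite ge0_ler_powR ?nnegrE ?ler_nat // ltW. Qed.

Lemma dweight_noninc n : (0 < n)%N -> dweight n.+1 <= dweight n.
Proof.
move=> n0; have n0R : (0 : R) < n%:R by rewrite ltr0n.
apply: ler_pM; rewrite ?invr_ge0 ?sqrtr_ge0 ?powR_ge0 //.
  by rewrite lef_pV2 ?posrE ?sqrtr_gt0 ?ltr0n // ler_wsqrtr // ler_nat.
by rewrite lef_pV2 ?posrE ?powR_gt0 ?ltr0n // natr_powR_le.
Qed.

Lemma dweight_sqr n : dweight n ^+ 2 = n%:R^-1 * (n%:R `^ eta) ^- 2.
Proof. by rewrite /dweight exprMn exprVn sqr_sqrtr // exprVn. Qed.

(** A discrete form of integrating [t ^ -(1 + 2 * eta)], by [ln n - ln (n - 1) >= 1 / n] and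
    [expR t >= 1 + t]. *)
Lemma dweight_sqr_telescope n : (1 < n)%N ->
  dweight n ^+ 2 <=
  (2 * eta)^-1 * ((n.-1%:R `^ eta) ^- 2 - (n%:R `^ eta) ^- 2).
Proof.
case: n => [//|[//|m]] _ /=; rewrite dweight_sqr.
set r := m.+1%:R `^ eta; set s := m.+2%:R `^ eta.
have s0 : 0 < s by rewrite powR_gt0.
have r0 : 0 < r by rewrite powR_gt0.
have rE : r ^- 2 = s ^- 2 * expR (2 * eta * (ln m.+2%:R - ln m.+1%:R)).
  rewrite /r /s /powR !pnatr_eq0 /= -!expRM_natl -!expRN -expRD; congr expR.
  by ring.
have ln1 : m.+2%:R^-1 <= ln m.+2%:R - ln m.+1%:R :> R.
  have -> : ln m.+2%:R - ln m.+1%:R = - ln (1 - m.+2%:R^-1) :> R.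
    have -> : 1 - m.+2%:R^-1 = m.+1%:R / m.+2%:R :> R.
      rewrite -[m.+2%:R]natr1; have := ltr0Sn R m; move: (m.+1%:R) => a a0.
      by field; rewrite gt_eqF //; lra.
    by rewrite ln_div ?posrE ?ltr0n // opprB.
  by rewrite lerNr; apply: le_ln1Dx; rewrite ltrN2 invf_lt1 ?ltr1n ?ltr0n.
rewrite -ler_pdivrMl ?invr_gt0 ?mulr_gt0 // invrK rE.
have e1 : 1 + 2 * eta / m.+2%:R <= expR (2 * eta * (ln m.+2%:R - ln m.+1%:R)).
  apply: le_trans (expR_ge1Dx _); rewrite lerD2l.
  by rewrite ler_wpM2l // mulr_ge0 // ltW.
have -> : 2 * eta * (m.+2%:R^-1 * s ^- 2) = s ^- 2 * (1 + 2 * eta / m.+2%:R) - s ^- 2 by ring.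
by rewrite lerD2r ler_wpM2l // invr_ge0 sqr_ge0.
Qed.

Lemma dweight_tail (tau : R) : 0 < tau ->
  exists2 N0 : nat, (0 < N0)%N & forall N, (N0 <= N)%N ->
    forall B, \sum_(N.+1 <= n < B) dweight n ^+ 2 <= tau.
Proof.
move=> tau0; pose c := (2 * eta)^-1; have c0 : 0 < c by rewrite invr_gt0 mulr_gt0.
(* The tail after [N] telescopes to at most [c * N ^ (- 2 * eta)], and [z - 1] is the point where
   this equals [tau]. *)
pose z := 1 + (c / tau) `^ (2 * eta)^-1.
have z0 : 0 < z by rewrite ltr_pwDl ?powR_ge0.
exists (Num.truncn z).+1 => // N zN B.
have Nz : z <= N%:R.
  by apply: le_trans (ltW (truncnS_gt z)) _; rewrite ler_nat.
have N0 : (0 < N)%N by apply: leq_trans zN.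
have tel : \sum_(N.+1 <= n < B) dweight n ^+ 2 <= c * (N%:R `^ eta) ^- 2.
  case: (ltnP N B) => NB; last first.
    by rewrite big_geq ?leqW // mulr_ge0 ?(ltW c0) // invr_ge0 sqr_ge0.
  apply: (@le_trans _ _ (\sum_(N.+1 <= n < B)
     c * ((n.-1%:R `^ eta) ^- 2 - (n%:R `^ eta) ^- 2))).
    rewrite big_nat [leRHS]big_nat; apply: ler_sum => n /andP[Nn _].
    by apply: dweight_sqr_telescope; apply: leq_ltn_trans Nn.
  rewrite -mulr_sumr ler_wpM2l ?(ltW c0) //.
  rewrite big_add1 /=; case: B NB => // B NB /=.
  rewrite (eq_bigr (fun i => - ((i.+1%:R `^ eta) ^- 2 - (i%:R `^ eta) ^- 2))); last first.
    by move=> i _; rewrite opprB.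
  rewrite sumrN telescope_sumr // opprB gerBl invr_ge0 sqr_ge0 //.
apply: le_trans tel _; rewrite -ler_pdivlMl // mulrC.
rewrite -[leRHS]invrK lef_pV2 ?posrE ?exprn_gt0 ?powR_gt0 ?ltr0n ?invr_gt0 ?divr_gt0 //.
rewrite invf_div -powR_mulrn ?powR_ge0 // -powRrM.
have -> : c / tau = ((c / tau) `^ (2 * eta)^-1) `^ (eta * 2).
  by rewrite -powRrM (mulrC eta) mulVf ?powRr1 ?divr_ge0 ?gt_eqF ?mulr_gt0 // ltW.
rewrite ge0_ler_powR ?nnegrE ?powR_ge0 ?mulr_ge0 ?(ltW eta0) //.
by apply: le_trans Nz; rewrite lerDr.
Qed.

End dirichlet_weight.

(** This is [n ^ (-3/2) / 4], a substitute for the differences of [dweight eta] that does not depend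
    on [eta]. *)
Definition vweight {R : realType} (n : nat) : R := (4 * (n%:R * Num.sqrt n%:R))^-1.

Lemma vweight_ge0 (R : realType) n : 0 <= vweight n :> R.
Proof. by rewrite invr_ge0 !mulr_ge0 ?sqrtr_ge0. Qed.

Lemma vweight_le_diff (R : realType) n : (0 < n)%N ->
  vweight n <= (Num.sqrt n%:R)^-1 - (Num.sqrt n.+1%:R)^-1 :> R.
Proof.
move=> n0; rewrite /vweight -{1}(sqr_sqrtr (ler0n R n)) -[n.+1%:R]natr1.
have : 1 <= Num.sqrt n%:R :> R by rewrite -[leLHS]sqrtr1 ler_wsqrtr // ler1n.
have : Num.sqrt (n%:R + 1) ^+ 2 = Num.sqrt n%:R ^+ 2 + 1 :> R.
  by rewrite !sqr_sqrtr // addr_ge0.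
have := sqrtr_ge0 (n%:R + 1 : R).
move: (Num.sqrt n%:R) (Num.sqrt _) => a b b0 bE a1.
have ab : a < b by nra.
(* As [b ^ 2 = a ^ 2 + 1 <= 2 * a ^ 2]. Hence [b * (a + b) <= 15 / 4 * a ^ 2], which is why
   [vweight] has the constant 4. *)
have bb : 2 * b <= 3 * a by nra.
have -> : a^-1 - b^-1 = (a * b * (a + b))^-1.
  have -> : (a * b * (a + b))^-1 = (b ^+ 2 - a ^+ 2) / (a * b * (a + b)).
    by rewrite bE addrAC subrr add0r mul1r.
  by field; rewrite !gt_eqF //; lra.
rewrite lef_pV2 ?posrE ?mulr_gt0 ?exprn_gt0 //; try lra.
have -> : 4 * (a ^+ 2 * a) = a * (4 * a ^+ 2) by ring.
rewrite -mulrA ler_pM2l; last by lra.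
by nra.
Qed.

(** Since [n ^ eta] is nondecreasing and at most 2 at [n], passing from differences of [1 / sqrt n]
    to those of [dweight eta] loses at most a factor 2. *)
Lemma vweight_le_dweight (R : realType) (eta : R) n : 0 < eta -> (0 < n)%N ->
  n%:R `^ eta <= 2 -> vweight n <= 2 * (dweight eta n - dweight eta n.+1).
Proof.
move=> eta0 n0 r2; apply: le_trans (vweight_le_diff R n0) _; rewrite /dweight.
have := natr_powR_le eta0 (leqnSn n).
have r0 : 0 < n%:R `^ eta by rewrite powR_gt0 ?ltr0n.
have ab : (Num.sqrt n.+1%:R)^-1 <= (Num.sqrt n%:R)^-1 :> R.
  by rewrite lef_pV2 ?posrE ?sqrtr_gt0 ?ltr0n // ler_wsqrtr // ler_nat.
have b0 : 0 <= (Num.sqrt n.+1%:R)^-1 :> R by rewrite invr_ge0 sqrtr_ge0.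
move: ((Num.sqrt n.+1%:R)^-1) ((Num.sqrt n%:R)^-1) b0 ab => b a b0 ab.
move: (n%:R `^ eta) (n.+1%:R `^ eta) r0 r2 => r r' r0 r2 rr'.
have : r'^-1 <= r^-1 by rewrite lef_pV2 ?posrE //; lra.
have : 2^-1 <= r^-1 by rewrite lef_pV2 ?posrE.
move: (r^-1) (r'^-1) => s s' s2 ss'.
by nra.
Qed.

Lemma exists_powR_le2 (R : realType) (X : nat) : (0 < X)%N ->
  exists2 eta : R, 0 < eta & X%:R `^ eta <= 2.
Proof.
move=> X0; have l0 : 0 <= ln X%:R :> R by rewrite ln_ge0 // ler1n.
have l2 : 0 < ln 2 :> R by rewrite ln_gt0 // ltr1n.
(* [X ^ eta] is [expR (eta * ln X)]; the 1 keeps the denominator positive at [X = 1]. *)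
exists (ln 2 / (1 + ln X%:R)); first by rewrite divr_gt0 //; lra.
rewrite /powR pnatr_eq0 gtn_eqF // -[leRHS](@lnK R) ?posrE // ler_expR.
rewrite mulrAC ler_pdivrMr; last by lra.
by rewrite ler_pM2l //; lra.
Qed.

(** * A constant sign makes the weighted sum of the partial sums bounded *)

Definition one_signed {R : realType} (x0 N : nat) (x : nat -> R) : Prop :=
  (forall n, (x0 <= n <= N)%N -> 0 <= msum x n) \/
  (forall n, (x0 <= n <= N)%N -> msum x n <= 0).

(** The order of choices matters: first [Q], making the sum of [1 / p] large; then [eta], with
    [n ^ eta <= 2] up to both [X] and [Q]; then [N], making the tail for this [eta] small. *)
Lemma avg_one_signed_large (R : realType) (x0 X : nat) (eps : R) : 0 < eps ->
  exists2 N, (X <= N)%N & forall y, signs y ->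
    avg N.+1 (fun x => ind (one_signed x0 N x /\
      4 + 4 * x0%:R ^+ 2 < \sum_(1 <= n < X.+1) `|msum x n| * vweight n)) y <= eps.
Proof.
(* So [expR (- L) = eps / 2]. In [32 * L], a factor 8 pays for the exponent in [avg_dsum_gt2] and a
   factor 4 for [dweight eta p ^+ 2 >= 1 / (4 * p)]. *)
move=> eps0; pose L : R := - ln (eps / 2).
have [Q HQ] := sum_inv_primes_unbounded (32 * L).
pose X' := maxn (maxn X Q) 1; have X'0 : (0 < X')%N by rewrite leq_max orbT.
have XX' : (X <= X')%N by rewrite !leq_max leqnn.
have QX' : (Q <= X')%N by rewrite !leq_max leqnn orbT.
have [eta eta0 X'2] := @exists_powR_le2 R X' X'0.
have e20 : 0 < eps / 2 by rewrite divr_gt0.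
have [N0 _ HN0] := dweight_tail eta0 e20.
pose N := maxn (maxn N0 x0) X'.+1.
have NN0 : (N0 <= N)%N by rewrite !leq_max leqnn.
have x0N : (x0 <= N)%N by rewrite !leq_max leqnn orbT.
have X'N : (X' < N)%N by rewrite !leq_max leqnn orbT.
exists N => [|y sy]; first exact: leq_trans XX' (ltnW X'N).
have hd := dweight_noninc eta0.
apply: (@le_trans _ _ (avg N.+1 (fun x =>
    ind (2 < `|\sum_(1 <= n < N.+1) rmf x n * dweight eta n|)) y)).
  apply: avg_le => // x sx; apply: ind_le => -[os]; rewrite !ltNge; apply: contraNN => A2.
  have := sum_normr_msum_le (dweight_ge0 eta) hd (dweight1 eta) sx x0N
            (leq_ltn_trans XX' X'N) A2 os.
  rewrite -(ler_pM2l (ltr0Sn _ 1)) mulrDr mulrA -!natrM; apply: le_trans.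
  rewrite mulr_sumr big_nat [leRHS]big_nat; apply: ler_sum => n /andP[n0 nX].
  rewrite mulrCA ler_wpM2l // vweight_le_dweight //.
  by apply: le_trans X'2; apply: natr_powR_le => //; apply: leq_trans XX'.
apply: le_trans (avg_dsum_gt2 (dweight_ge0 eta) hd (dweight1 eta) (dweightM eta) sy (HN0 _ NN0)) _.
rewrite [leRHS](splitr eps) lerD2r -[leRHS](@lnK R) ?posrE // ler_expR.
suff : 8 * L <= \sum_(p <- primes_below N.+1) dweight eta p ^+ 2 by rewrite /L; lra.
apply: (@le_trans _ _ (\sum_(p <- primes_below Q.+1) dweight eta p ^+ 2)); last first.
  apply: ler_sum_subset => [|||p _]; rewrite ?uniq_primes_below ?sqr_ge0 //.
  move=> p; rewrite !mem_primes_below ltnS => /andP[-> pQ] /=.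
  by rewrite ltnS (leq_trans pQ) // (leq_trans QX') // ltnW.
apply: (@le_trans _ _ (\sum_(p <- primes_below Q.+1) 4^-1 * p%:R^-1)).
  by rewrite -mulr_sumr; move: HQ; lra.
rewrite big_seq [leRHS]big_seq; apply: ler_sum => p.
rewrite mem_primes_below ltnS => /andP[/prime_gt0 p0 pQ].
rewrite dweight_sqr mulrC ler_wpM2l ?invr_ge0 //.
have r2 : p%:R `^ eta <= 2.
  by apply: le_trans X'2; apply: natr_powR_le => //; apply: leq_trans QX'.
have r0 : 0 < p%:R `^ eta by rewrite powR_gt0 ?ltr0n.
rewrite lef_pV2 ?posrE ?exprn_gt0 //.
by nra.
Qed.

(** * Divergence of the weighted sum of the partial sums *)

Definition top_primes (n : nat) : seq nat :=
  [seq p <- primes_below n.+1 | (n < 2 * p)%N].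

Lemma mem_top_primes n p :
  (p \in top_primes n) = [&& prime p, (p <= n)%N & (n < 2 * p)%N].
Proof. by rewrite mem_filter mem_primes_below ltnS andbC andbA. Qed.

Lemma uniq_top_primes n : uniq (top_primes n).
Proof. by rewrite filter_uniq ?uniq_primes_below. Qed.

Lemma size_top_primes_le n : (size (top_primes n) <= n)%N.
Proof.
rewrite -[leqRHS](size_iota 1); apply: uniq_leq_size (uniq_top_primes n) _ => p.
by rewrite mem_top_primes mem_iota add1n ltnS => /and3P[/prime_gt0 -> ->].
Qed.

(** * Anticoncentration of the partial sums by second and fourth moments *)

Section anticoncentration.
Context {R : realType}.
Implicit Types x y : nat -> R.

(* A multiple of [p] other than [p] itself is at least [2 p], hence exceeds
   [n]: the top primes enter [msum x n] only through the terms [n = p]. *)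
Lemma msum_flip_top x n :
  msum (flip (mem (top_primes n)) x) n = msum x n - 2 * \sum_(p <- top_primes n) x p.
Proof.
have -> : \sum_(p <- top_primes n) x p =
    \sum_(1 <= k < n.+1) if k \in top_primes n then x k else 0.
  rewrite -big_mkcond -[RHS]big_filter; apply: perm_big.
  apply: uniq_perm; rewrite ?filter_uniq ?iota_uniq ?uniq_primes_below // => p.
  rewrite [RHS]mem_filter mem_index_iota ltnS; case: (boolP (p \in top_primes n)) => //=.
  by rewrite mem_top_primes => /and3P[/prime_gt0 -> ->].
rewrite mulr_sumr -sumrB; apply: eq_big_nat => k /andP[k0 kn].
have [kt|kt] := boolP (k \in top_primes n).
  have kp : prime k by move: kt; rewrite mem_top_primes => /and3P[].
  have sqk := squarefree_prime kp.
  by rewrite /rmf asboolT // primes_prime // !big_seq1 /flip /= kt; ring.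
rewrite mulr0 subr0; apply: rmf_flip_id => p; rewrite mem_primes => /and3P[pp _ pk].
apply: contra kt; rewrite /= mem_top_primes => /and3P[_ pn n2p].
case/dvdnP: pk => q kE; have q1 : q = 1%N.
  move: k0 kn n2p; rewrite kE; case: q {kE} => [|[|q]] //.
  by rewrite ltnS !mulSn => _ h1 h2; lia.
by rewrite kE q1 mul1n mem_top_primes pp pn.
Qed.

Lemma avg_symmetrize k p (Phi : (nat -> R) -> R) x : (p < k)%N ->
  avg k (fun y => (Phi y + Phi (flip (pred1 p) y)) / 2) x = avg k Phi x.
Proof.
move=> pk; have fl := @avg_flip R k (pred1 p) Phi x.
have -> : (fun y => (Phi y + Phi (flip (pred1 p) y)) / 2) =
          (fun y => 2^-1 * (Phi y + Phi (flip (pred1 p) y))).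
  by apply/funext => y; rewrite mulrC.
rewrite avgZ avgD fl; first by field.
by move=> q /eqP ->.
Qed.

Section moments.
Variables (k : nat) (G : (nat -> R) -> R) (x : nat -> R).
Hypothesis sx : signs x.

Let sum_flip (s : seq nat) p y : p \notin s ->
  \sum_(q <- s) flip (pred1 p) y q = \sum_(q <- s) y q.
Proof.
move=> ps; apply: eq_big_seq => q qs; rewrite /flip /=; case: eqP => // qp.
by rewrite -qp qs in ps.
Qed.

(** Symmetrizing at [p] cancels the cross term. The weight [G] ignores the signs in [s], so that
    with an indicator for [G] this is a conditional second moment. *)
Lemma avg_sqr_sum (s : seq nat) : uniq s -> (forall p, p \in s -> (p < k)%N) ->
  (forall p y, p \in s -> G (flip (pred1 p) y) = G y) ->
  avg k (fun y => G y * (\sum_(p <- s) y p) ^+ 2) x = (size s)%:R * avg k G x.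
Proof.
elim: s => [|p s IH] /=.
  move=> _ _ _; rewrite mul0r -[RHS](avg_cst k 0 x); apply: eq_avg => // y _.
  by rewrite big_nil expr0n mulr0.
move=> /andP[ps us] sk sG; have pk : (p < k)%N by apply: sk; rewrite inE eqxx.
rewrite -(avg_symmetrize _ _ pk) -[(size s).+1%:R]natr1 mulrDl mul1r -IH //; last 2 first.
- by move=> q qs; apply: sk; rewrite inE qs orbT.
- by move=> q y qs; apply: sG; rewrite inE qs orbT.
rewrite -avgD; apply: eq_avg => // y sy.
rewrite sG ?inE ?eqxx // !big_cons sum_flip // {1}/flip /= eqxx.
by case: (sy p) => ->; field.
Qed.

(** The mean of [(b + 1) ^ 4] and [(b - 1) ^ 4] is [b ^ 4 + 6 * b ^ 2 + 1], and
    [3 * n ^ 2 + 6 * n + 1 <= 3 * (n + 1) ^ 2]. *)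
Lemma avg_pow4_sum (s : seq nat) : uniq s -> (forall p, p \in s -> (p < k)%N) ->
  (forall p y, p \in s -> G (flip (pred1 p) y) = G y) -> (forall y, 0 <= G y) ->
  avg k (fun y => G y * (\sum_(p <- s) y p) ^+ 4) x <= 3 * (size s)%:R ^+ 2 * avg k G x.
Proof.
move=> + + + G0; have g0 : 0 <= avg k G x by apply: avg_ge0.
elim: s => [|p s IH] /=.
  move=> _ _ _; rewrite expr0n mulr0 mul0r -[leRHS](avg_cst k 0 x).
  by apply: avg_le => // y _; rewrite big_nil expr0n mulr0.
move=> /andP[ps us] sk sG; have pk : (p < k)%N by apply: sk; rewrite inE eqxx.
have sk' q : q \in s -> (q < k)%N by move=> qs; apply: sk; rewrite inE qs orbT.
have sG' q y : q \in s -> G (flip (pred1 q) y) = G y.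
  by move=> qs; apply: sG; rewrite inE qs orbT.
rewrite -(avg_symmetrize _ _ pk).
rewrite (@eq_avg _ _ _ (fun y => G y * (\sum_(q <- s) y q) ^+ 4 +
   (6 * (G y * (\sum_(q <- s) y q) ^+ 2) + G y))) //; last first.
  move=> y sy; rewrite sG ?inE ?eqxx // !big_cons sum_flip // {1}/flip /= eqxx.
  by case: (sy p) => ->; field.
rewrite !avgD avgZ avg_sqr_sum // -[(size s).+1%:R]natr1.
have := IH us sk' sG'; move: ((size s)%:R) (ler0n R (size s)) => n n0.
by move: (avg k G x) (avg _ _ _) g0 => g b g0; nra.
Qed.

(** A polynomial minorant of the indicator reduces this to the two moments: they give
    [1/2 - 3/16 - 31/256 = 49/256], which is at least [3/16]. *)
Lemma avg_sum_anticoncentration (s : seq nat) (u : R) :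
  uniq s -> (forall p, p \in s -> (p < k)%N) ->
  (forall p y, p \in s -> G (flip (pred1 p) y) = G y) -> (forall y, 0 <= G y) ->
  0 <= u -> u ^+ 2 <= (size s)%:R / 4 ->
  3 / 16 * avg k G x <= avg k (fun y => G y * ind (u <= `|\sum_(p <- s) y p|)) x.
Proof.
move=> us sk sG G0 u0 u2; have g0 : 0 <= avg k G x by apply: avg_ge0.
have [s0|n0] := eqVneq (size s) 0%N.
  have -> : u = 0 by move: u2; rewrite s0 mul0r; nra.
  rewrite (@eq_avg _ _ (fun y => _ * ind _) G) //; first by lra.
  by move=> y _; rewrite indT ?mulr1 // normr_ge0.
have n0R : 0 < (size s)%:R :> R by rewrite ltr0n lt0n.
set n : R := (size s)%:R in u2 n0R *.
(* On [b ^+ 2 <= n / 4] the concave function [z / 2 - z ^+ 2 / 16] of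
   [z = b ^+ 2 / n] is at most [31 / 256], and it is at most 1 everywhere. *)
have pt b : (2 * n)^-1 * b ^+ 2 - (16 * n ^+ 2)^-1 * b ^+ 4 - 31 / 256 <= ind (u <= `|b|) :> R.
  have b4 : b ^+ 4 = (b ^+ 2) ^+ 2 by rewrite -exprM.
  have -> : (2 * n)^-1 * b ^+ 2 - (16 * n ^+ 2)^-1 * b ^+ 4 =
     (b ^+ 2 / n) / 2 - (b ^+ 2 / n) ^+ 2 / 16 by rewrite b4; field; rewrite gt_eqF.
  have z0 : 0 <= b ^+ 2 / n by rewrite divr_ge0 ?sqr_ge0 // ltW.
  have [ub|ub] := pselect (u <= `|b|); first rewrite indT //.
    by have := sqr_ge0 (b ^+ 2 / n - 4); move: (b ^+ 2 / n) => z; lra.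
  rewrite indF //; have z4 : b ^+ 2 / n <= 4^-1.
    rewrite ler_pdivrMr // mulrC; apply: le_trans u2.
    rewrite -[b ^+ 2]real_normK ?num_real //.
    by move/negP: ub; rewrite -ltNge => /ltW bu; rewrite ler_pXn2r ?nnegrE.
  by move: (b ^+ 2 / n) z0 z4 => z z0 z4; nra.
apply: (@le_trans _ _ (avg k (fun y => (2 * n)^-1 * (G y * (\sum_(p <- s) y p) ^+ 2) +
   (- (16 * n ^+ 2)^-1 * (G y * (\sum_(p <- s) y p) ^+ 4) + - (31 / 256) * G y)) x)).
  rewrite !avgD !avgZ avg_sqr_sum // -/n.
  have := avg_pow4_sum us sk sG G0; rewrite -/n; move: (avg _ _ _) (avg _ G _) g0 => b g g0 bg.
  have : (16 * n ^+ 2)^-1 * b <= 3 / 16 * g.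
    rewrite -ler_pdivlMl ?invr_gt0 ?mulr_gt0 ?exprn_gt0 // invrK.
    by apply: le_trans bg _; lra.
  have -> : (2 * n)^-1 * (n * g) = g / 2 by field; rewrite gt_eqF.
  by lra.
apply: avg_le => // y _; apply: le_trans (ler_wpM2l (G0 y) (pt _)).
by rewrite le_eqVlt; apply/orP; left; apply/eqP; ring.
Qed.

End moments.

(** It is at most half the square root of the number of top primes, and linear in that number, so
    that a sum over [n] can be rearranged into one over primes. *)
Definition msum_scale (n : nat) : R := (size (top_primes n))%:R / (2 * Num.sqrt n%:R).

Lemma msum_scale_ge0 n : 0 <= msum_scale n.
Proof. by rewrite divr_ge0 ?mulr_ge0 ?sqrtr_ge0. Qed.

Lemma msum_scale_sqr n : msum_scale n ^+ 2 <= (size (top_primes n))%:R / 4.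
Proof.
have := size_top_primes_le n; rewrite /msum_scale; case: n => [|n] ns.
  by move: ns; rewrite leqn0 => /eqP ->; rewrite !mul0r expr0n.
rewrite expr_div_n exprMn sqr_sqrtr //.
have n0 : (0 : R) < n.+1%:R by rewrite ltr0n.
have s0 := ler0n R (size (top_primes n.+1)); rewrite -(@ler_nat R) in ns.
move: (size _)%:R n.+1%:R ns n0 s0 => s m sm m0 s0.
rewrite ler_pdivrMr ?mulr_gt0 ?exprn_gt0 //.
have -> : s / 4 * (2 ^+ 2 * m) = s * m by field.
by rewrite expr2 ler_wpM2l.
Qed.

(** Flipping all top primes changes [msum y n] by twice their sum [b], so one of the two values is
    at least [|b|] in absolute value; this halves the constant [3 / 16]. *)
Lemma avg_msum_anticoncentration k (G : (nat -> R) -> R) x n : signs x -> (n < k)%N ->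
  (forall (A : pred nat) y, (forall p, A p -> (n < 2 * p)%N) -> G (flip A y) = G y) ->
  (forall y, 0 <= G y) ->
  3 / 32 * avg k G x <= avg k (fun y => G y * ind (msum_scale n <= `|msum y n|)) x.
Proof.
move=> sx nk GA G0.
have Gp p y : p \in top_primes n -> G (flip (pred1 p) y) = G y.
  by rewrite mem_top_primes => /and3P[_ _ n2p]; apply: GA => q /eqP ->.
have tk p : p \in top_primes n -> (p < k)%N.
  by rewrite mem_top_primes => /and3P[_ pn _]; apply: leq_ltn_trans nk.
have := avg_sum_anticoncentration sx (uniq_top_primes n) tk Gp G0
  (msum_scale_ge0 n) (msum_scale_sqr n).
set L := avg k _ x; set Rh := avg k _ x.
suff : Rh <= 2 * avg k (fun y => G y * ind (msum_scale n <= `|msum y n|)) x by lra.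
set Phi := (fun y => _).
have fl : avg k (fun y => Phi (flip (mem (top_primes n)) y)) x = avg k Phi x.
  by apply: avg_flip => p; exact: tk.
have -> : 2 * avg k Phi x = avg k (fun y => Phi y + Phi (flip (mem (top_primes n)) y)) x.
  by rewrite avgD fl; ring.
apply: avg_le => // y sy; rewrite /Phi GA; last first.
  by move=> p; rewrite /= mem_top_primes => /and3P[].
rewrite -mulrDr ler_wpM2l // msum_flip_top.
move: (\sum_(p <- _) _) (msum y n) (msum_scale n) => b m u.
have [mu|mu] := pselect (u <= `|m|); first by rewrite (indT mu) ler_wpDr ?ind_ge0 ?ind_le1.
rewrite (indF mu) add0r; apply: ind_le => ub; move/negP: mu; rewrite -ltNge => mu.
have : `|2 * b| <= `|m| + `|m - 2 * b|.
  have e : 2 * b = m - (m - 2 * b) by ring.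
  by rewrite {1}e ler_normB.
by rewrite normrM ger0_norm //; lra.
Qed.

End anticoncentration.

(** The summand is [size (top_primes n) / (8 * n ^ 2)]. A prime [p] is a top prime for the [p]
    values [p <= n < 2 * p], each contributing at least [1 / (32 * p ^ 2)]: together
    [1 / (32 * p)]. *)
Lemma sum_msum_scale_unbounded (R : realType) (A : nat) (K : R) :
  exists B, K <= \sum_(A.+1 <= n < B) vweight n * msum_scale n.
Proof.
(* The primes up to [A] are discarded, and [A.+1] bounds the sum of their reciprocals. *)
have [P HP] := sum_inv_primes_unbounded (32 * K + A.+1%:R).
pose s := [seq p <- primes_below P.+1 | (A < p)%N].
have sum_s : 32 * K <= \sum_(p <- s) p%:R^-1.
  move: HP; rewrite (bigID (fun p => (A < p)%N)) /= -(big_filter _ (fun p => (A < p)%N)) -/s.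
  suff : \sum_(p <- primes_below P.+1 | ~~ (A < p)%N) p%:R^-1 <= A.+1%:R :> R by lra.
  rewrite -big_filter.
  apply: (@le_trans _ _ (\sum_(0 <= p < A.+1) 1)); last first.
    by rewrite big_const_nat iter_addr_0 subn0.
  apply: (@le_trans _ _ (\sum_(p <- [seq p <- primes_below P.+1 | ~~ (A < p)%N]) 1)).
    rewrite big_seq [leRHS]big_seq; apply: ler_sum => p.
    rewrite mem_filter mem_primes_below => /and3P[_ /prime_gt0 p0 _].
    by rewrite invf_le1 ?ltr0n // ler1n.
  apply: ler_sum_subset => //; rewrite ?filter_uniq ?iota_uniq //.
  by move=> p; rewrite mem_filter mem_index_iota -leqNgt ltnS => /andP[].
exists (2 * P).+1.
apply: (@le_trans _ _ (\sum_(A.+1 <= n < (2 * P).+1) \sum_(p <- s)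
    if (p <= n < 2 * p)%N then (8 * n%:R ^+ 2)^-1 else 0)); last first.
  rewrite big_nat [leRHS]big_nat; apply: ler_sum => n /andP[An _].
  have n0 : (0 : R) < n%:R by rewrite ltr0n; apply: leq_ltn_trans An.
  have -> : vweight n * msum_scale n = (size (top_primes n))%:R * (8 * n%:R ^+ 2)^-1 :> R.
    rewrite /vweight /msum_scale.
    have := sqr_sqrtr (ltW n0); have : 0 < Num.sqrt n%:R :> R by rewrite sqrtr_gt0.
    by move: (Num.sqrt _) => q q0 <-; field; rewrite gt_eqF.
  rewrite -big_mkcond /= -big_filter big_const_seq count_predT iter_addr_0 -[leLHS]mulr_natl.
  rewrite ler_wpM2r ?invr_ge0 ?mulr_ge0 ?exprn_ge0 // ler_nat.
  apply: uniq_leq_size => [|p]; first by rewrite ?filter_uniq ?iota_uniq.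
  rewrite mem_filter /s mem_filter mem_primes_below mem_top_primes.
  by move=> /andP[/andP[-> ->] /and3P[_ -> _]].
rewrite exchange_big /=.
apply: (@le_trans _ _ (\sum_(p <- s) 32^-1 * p%:R^-1)).
  by rewrite -mulr_sumr; lra.
rewrite big_seq [leRHS]big_seq; apply: ler_sum => p.
rewrite mem_filter mem_primes_below ltnS => /and3P[Ap /prime_gt0 p0 pP].
have p0R : (0 : R) < p%:R by rewrite ltr0n.
apply: (@le_trans _ _ (\sum_(p <= n < 2 * p) (32 * p%:R ^+ 2)^-1)).
  rewrite big_const_nat iter_addr_0 mul2n -addnn addnK -[leRHS]mulr_natl.
  by rewrite le_eqVlt; apply/orP; left; apply/eqP; field; rewrite gt_eqF.
rewrite -big_mkcond -[leRHS]big_filter.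
apply: (@le_trans _ _ (\sum_(p <= n < 2 * p) (8 * n%:R ^+ 2)^-1)).
  rewrite big_nat [leRHS]big_nat; apply: ler_sum => n /andP[pn n2p].
  have n0 : (0 : R) < n%:R by rewrite ltr0n (leq_trans p0).
  rewrite lef_pV2 ?posrE ?mulr_gt0 ?exprn_gt0 //.
  have : n%:R <= 2 * p%:R :> R by rewrite -natrM ler_nat ltnW.
  by nra.
apply: ler_sum_subset => [|||n _]; rewrite ?iota_uniq ?filter_uniq ?iota_uniq //.
  move=> n; rewrite mem_filter !mem_index_iota => /andP[pn n2p].
  by rewrite pn n2p (leq_trans Ap pn) /= ltnS (leq_trans (ltnW n2p)) ?leq_mul2l.
Qed.

(* The quantities [g X] below decrease to a limit; past an [X] where they are
   almost stationary, conditioning on the event of [X] is almost conditioning on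
   the event of [X'], on which the sum over [2 X < n <= X'] is at most [K],
   although its conditional mean is at least a multiple of the divergent sum of
   [vweight n * msum_scale n]. *)
Lemma avg_sum_normr_msum_small (R : realType) (K eps : R) (y : nat -> R) :
  signs y -> 0 <= K -> 0 < eps ->
  exists X, forall Z, (X < Z)%N ->
    avg Z (fun x => ind (\sum_(1 <= n < X.+1) `|msum x n| * vweight n <= K)) y <= eps.
Proof.
move=> sy K0 eps0.
pose S X (x : nat -> R) : R := \sum_(1 <= n < X.+1) `|msum x n| * vweight n.
pose G X (x : nat -> R) : R := ind (S X x <= K).
have S_mono X X' x : (X <= X')%N -> S X x <= S X' x.
  move=> XX'; rewrite /S [leRHS](@big_cat_nat _ _ _ X.+1) //= lerDl.
  by rewrite sumr_ge0 // => n _; rewrite mulr_ge0 // vweight_ge0.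
have G_flip X (A : pred nat) x : (forall p, A p -> (X < p)%N) -> G X (flip A x) = G X x.
  move=> XA; rewrite /G /S; congr (ind (_ <= _)); apply: eq_big_nat => n /andP[_ nX].
  rewrite msum_flip_id // => p _ pn; apply/negP => /XA; rewrite ltnNge.
  by rewrite (leq_trans pn).
pose g X := avg X.+1 (G X) y.
have gE X Z : (X < Z)%N -> avg Z (G X) y = g X.
  by move=> XZ; apply: avg_stable => // j x Xj; apply: G_flip => p /eqP ->.
have g_ge0 X : 0 <= g X by apply: avg_ge0 => // x _; exact: ind_ge0.
(* The final inequality is [3 / 32 * g X <= 2 * eta]. *)
pose eta := 3 / 64 * eps; have eta0 : 0 < eta by rewrite /eta; lra.
have [X HX] : exists X, forall X', (X <= X')%N -> g X - g X' <= eta.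
  have hinf : has_inf (range g).
    by split; [exists (g 0%N), 0%N | exists 0 => _ [X _ <-]].
  have [_ [X _ <-] HX] := inf_adherent eta0 hinf.
  exists X => X' _; have : inf (range g) <= g X' by apply: ge_inf; [exact: hinf.2 | exists X'].
  by lra.
exists X => Z XZ; rewrite -/(G X) (gE _ _ XZ).
(* Beyond [2 * X] the top primes exceed [X], so [G X] ignores them; the size of the sum gives
   [K <= eta * m]. *)
have [B HB] := sum_msum_scale_unbounded (2 * X) (K / eta + 1).
pose X' := maxn B X; have XX' : (X <= X')%N by rewrite leq_maxr.
set m := \sum_(_ <= n < _) _ in HB.
(* Truncating [|msum x n|] to [msum_scale n] gives a variable bounded both by [S X' x] and by the
   constant [m]. *)
pose Y (x : nat -> R) : R := \sum_((2 * X).+1 <= n < B)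
   (vweight n * msum_scale n) * ind (msum_scale n <= `|msum x n|).
have Keta : 0 <= K / eta by rewrite divr_ge0 // ltW.
have m0 : 0 < m by lra.
have Y_lower : m * (3 / 32 * g X) <= avg X'.+1 (fun x => G X x * Y x) y.
  rewrite (@eq_avg _ _ _ (fun x => \sum_((2 * X).+1 <= n < B) (vweight n * msum_scale n) *
     (G X x * ind (msum_scale n <= `|msum x n|)))) //; last first.
    by move=> x _; rewrite /Y mulr_sumr; apply: eq_bigr => n _; ring.
  rewrite avg_sum mulr_suml big_nat [leRHS]big_nat; apply: ler_sum => n /andP[Xn nB].
  rewrite avgZ ler_wpM2l ?mulr_ge0 ?vweight_ge0 ?msum_scale_ge0 //.
  rewrite -(gE X X'.+1) //; apply: avg_msum_anticoncentration => //.
  - by rewrite ltnS (leq_trans (ltnW nB)) ?leq_maxl.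
  - move=> A x nA; apply: G_flip => p /nA n2p.
    by rewrite -(ltn_pmul2l (isT : 0 < 2)%N) (leq_trans Xn) // ltnW.
have Y_le_m x : Y x <= m.
  rewrite /Y /m; apply: ler_sum => n _; rewrite ler_piMr ?ind_le1 //.
  by rewrite mulr_ge0 ?vweight_ge0 ?msum_scale_ge0.
have Y_le_S x : Y x <= S X' x.
  apply: (@le_trans _ _ (\sum_((2 * X).+1 <= n < B) `|msum x n| * vweight n)).
    apply: ler_sum => n _; rewrite -mulrA [leRHS]mulrC ler_wpM2l ?vweight_ge0 //.
    have [h|h] := pselect (msum_scale n <= `|msum x n|); first by rewrite indT ?mulr1.
    by rewrite indF ?mulr0.
  apply: ler_sum_subset => [|||n _]; rewrite ?iota_uniq ?mulr_ge0 ?vweight_ge0 //.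
  move=> n; rewrite !mem_index_iota ltnS => /andP[Xn nB].
  by rewrite (leq_ltn_trans _ Xn) // (leq_trans (ltnW nB)) ?leq_maxl.
(* Where [S X' x <= K] use [Y x <= S X' x]; the rest of the event of [X] has mass [g X - g X'], and
   there [Y x <= m]. *)
have Y_upper : avg X'.+1 (fun x => G X x * Y x) y <= K * g X' + m * (g X - g X').
  have -> : K * g X' + m * (g X - g X') =
      avg X'.+1 (fun x => K * G X' x + m * (G X x + -1 * G X' x)) y.
    by rewrite avgD !avgZ avgD avgZ (gE X) // (gE X') // mulN1r.
  apply: avg_le => // x sx.
  have [SK|SK] := pselect (S X' x <= K).
    have SK' : S X x <= K by apply: le_trans SK; exact: S_mono.
    rewrite /G (indT SK) (indT SK') mul1r mulr1 mulN1r subrr mulr0 addr0.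
    by apply: le_trans SK; exact: Y_le_S.
  by rewrite /G (indF SK) !mulr0 add0r addr0 mulrC ler_wpM2r ?ind_ge0.
have gX'1 : g X' <= 1.
  by rewrite -(avg_cst X'.+1 1 y); apply: avg_le => // x _; exact: ind_le1.
have Km : K <= eta * m.
  by rewrite -ler_pdivrMl // mulrC; lra.
have gg : m * (g X - g X') <= m * eta by rewrite ler_wpM2l ?HX // ltW.
have KgX' : K * g X' <= K by rewrite ler_piMr.
have : m * (3 / 32 * g X) <= m * (2 * eta) by lra.
by rewrite ler_pM2l // /eta; lra.
Qed.

(** * Almost sure sign changes *)

(** The event splits according to whether the weighted sum up to [X] exceeds [K]. The bound fixing
    [X] holds at every later level, so [N] may be chosen after [X]. *)
Lemma avg_one_signed_small (R : realType) (x0 : nat) (eps : R) (y : nat -> R) :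
  signs y -> 0 < eps ->
  exists N, avg N.+1 (fun x => ind (one_signed x0 N x)) y <= eps.
Proof.
move=> sy eps0; have e20 : 0 < eps / 2 by rewrite divr_gt0.
pose K : R := 4 + 4 * x0%:R ^+ 2.
have K0 : 0 <= K by rewrite addr_ge0 ?mulr_ge0 ?exprn_ge0.
have [X HX] := avg_sum_normr_msum_small sy K0 e20.
have [N XN HN] := avg_one_signed_large x0 X e20; exists N.
have := lerD (HN y sy) (HX N.+1 XN); rewrite -splitr; apply: le_trans.
rewrite -avgD; apply: avg_le => // x _.
have [os|os] := pselect (one_signed x0 N x); last by rewrite indF // addr_ge0 ?ind_ge0.
rewrite indT //; have [h|h] := pselect (\sum_(1 <= n < X.+1) `|msum x n| * vweight n <= K).
  by rewrite (indT h) lerDr ind_ge0.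
by rewrite [X in X + _]indT ?lerDl ?ind_ge0 //; split=> //; rewrite ltNge; apply/negP.
Qed.

(** Intersect the covers for [eps = 1 / (n + 1)]; [A] itself is not assumed measurable. *)
Lemma negligible_of_small_covers d (T : measurableType d) (R : realType)
    (P : probability T R) (A : set T) :
  (forall eps : R, 0 < eps -> exists B, [/\ measurable B, A `<=` B & (P B <= eps%:E)%E]) ->
  P.-negligible A.
Proof.
move=> cover; have /choice[B HB] : forall n : nat, exists B, [/\ measurable B, A `<=` B &
    (P B <= (n.+1%:R^-1)%:E)%E].
  by move=> n; apply: cover; rewrite invr_gt0.
have mB : measurable (\bigcap_n B n) by apply: bigcapT_measurable => n; case: (HB n).
exists (\bigcap_n B n); split=> //; last by move=> w Aw n _; case: (HB n) => _ + _; apply.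
apply/eqP; rewrite eq_le measure_ge0 andbT; apply/lee_addgt0Pr => eps eps0.
rewrite add0e; have [_ _ Bn] := HB (Num.truncn eps^-1).
apply: (@le_trans _ _ (P (B (Num.truncn eps^-1)))).
  apply: le_measure; rewrite ?inE //; first by case: (HB (Num.truncn eps^-1)).
  by move=> w; apply.
apply: le_trans Bn _; rewrite lee_fin -[leRHS]invrK lef_pV2 ?posrE ?invr_gt0 ?ltr0n //.
by rewrite ltW // truncnS_gt.
Qed.

(** * From averages over signs to the probability space *)

Section transfer.
Context d (T : measurableType d) (R : realType) (P : probability T R).
Variable f : nat -> {RV P >-> R}.
Hypothesis hf : rademacher_rmf f.

Lemma rademacher_rmfE w n : (0 < n)%N -> f n w = rmf (fun p => f p w) n.
Proof.
move=> n0; rewrite /rmf; case: asboolP => sq.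
  exact: (rademacher_squarefree hf).
exact: (rademacher_nonsquarefree hf).
Qed.

Lemma negligible_not_sign p : prime p ->
  P.-negligible [set w | ~ (f p w = 1 \/ f p w = -1)].
Proof.
move=> pp.
have m1 : measurable (f p @^-1` [set 1]) by exact: measurable_funPTI.
have m2 : measurable (f p @^-1` [set -1]) by exact: measurable_funPTI.
exists (~` (f p @^-1` [set 1] `|` f p @^-1` [set -1])); split.
- by apply: measurableC; exact: measurableU.
- have PU : P (f p @^-1` [set 1] `|` f p @^-1` [set -1]) = ((2^-1)%:E + (2^-1)%:E)%E.
    rewrite measureU //.
      exact: (f_equal2 adde (rademacher_pos hf pp) (rademacher_neg hf pp)).
    rewrite -subset0 => w [/= -> /eqP]; rewrite -subr_eq0 opprK => /eqP.
    by lra.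
  rewrite probability_setC ?PU; last exact: measurableU.
  have -> : ((2^-1)%:E + (2^-1)%:E = 1 :> \bar R)%E.
    by rewrite -EFinD; congr EFin; field.
  by rewrite subee.
- by move=> w /= + [h|h]; apply; [left | right].
Qed.

(** The cylinder left when [avg] still has the coordinates below [k] to average. It constrains only
    primes, as independence is given only there. *)
Definition agree Z k (y : nat -> R) : set T :=
  [set w | forall p, prime p -> (k <= p < Z)%N -> f p w = y p].

Lemma agree0 Z y :
  agree Z 0 y = \bigcap_(p in [set` [fset p in primes_below Z]%fset]) (f p @^-1` [set y p]).
Proof.
apply/seteqP; split=> w /= h p.
  by rewrite /= inE mem_primes_below => /andP[pp pZ]; apply: h.
by move=> pp pZ; apply: h; rewrite /= inE mem_primes_below pp.
Qed.

Lemma measurable_agree0 Z y : measurable (agree Z 0 y).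
Proof.
rewrite agree0; apply: fin_bigcap_measurable => [|p _]; last exact: measurable_funPTI.
exact: finite_fset.
Qed.

Lemma prob_agree0 Z y : signs y ->
  P (agree Z 0 y) = ((2^-1) ^+ size (primes_below Z))%:E.
Proof.
move=> sy; rewrite agree0 (rademacher_indep hf); last 2 first.
- by move=> p; rewrite inE mem_primes_below => /andP[].
- by move=> p _; exact: measurable_set1.
rewrite (perm_big (primes_below Z)) /=; last first.
  apply: uniq_perm; rewrite ?fset_uniq ?uniq_primes_below // => p.
  by rewrite inE.
have : {in primes_below Z, forall p, P (f p @^-1` [set y p]) = (2^-1)%:E}.
  move=> p; rewrite mem_primes_below => /andP[pp _].
  by case: (sy p) => ->; [exact: (rademacher_pos hf) | exact: (rademacher_neg hf)].
elim: (primes_below Z) => [|p s IH] h; first by rewrite big_nil expr0.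
rewrite big_cons /= exprS EFinM -IH => [|q qs]; last by apply: h; rewrite inE qs orbT.
by rewrite h // inE eqxx.
Qed.

(** The recursion of [avg] is followed inside cylinders: at level 0 the cover is a whole cylinder or
    empty, and at a prime the covers for the two signs are united. *)
Lemma prob_cover_le_avg Z (Q : (nat -> R) -> Prop) y : signs y ->
  (forall x x', (forall p, prime p -> (p < Z)%N -> x p = x' p) -> Q x -> Q x') ->
  exists B, [/\ measurable B, (P B <= (avg Z (fun x => ind (Q x)) y)%:E)%E &
    forall w, (forall p, prime p -> f p w = 1 \/ f p w = -1) ->
      Q (fun p => f p w) -> B w].
Proof.
move=> sy Qdep.
(* The number of primes already fixed: [2 ^ - cnt k] is the expected probability of the cylinder
   [agree Z k z]. *)
pose cnt k := size [seq p <- primes_below Z | (k <= p)%N].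
suff H k : (k <= Z)%N -> forall z, signs z -> exists B, [/\ measurable B,
    (P B <= ((2^-1) ^+ cnt k * avg k (fun x => ind (Q x)) z)%:E)%E &
    forall w, (forall p, prime p -> f p w = 1 \/ f p w = -1) ->
      agree Z k z w -> Q (fun p => f p w) -> B w].
  have [B [mB PB HB]] := H Z (leqnn Z) y sy; exists B; split=> //.
    have c0 : cnt Z = 0%N.
      apply/eqP; rewrite /cnt size_filter -leqn0 leqNgt -has_count; apply/hasPn => p.
      by rewrite mem_primes_below -ltnNge => /andP[].
    by move: PB; rewrite c0 expr0 mul1r.
  by move=> w sw; apply: HB => // p _ /andP[/leq_ltn_trans h /h]; rewrite ltnn.
elim: k => [|k IH] kZ z sz.
  have c0 : cnt 0%N = size (primes_below Z) by rewrite /cnt (eq_filter (a2 := predT)) ?filter_predT.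
  have [Qz|Qz] := pselect (Q z).
    exists (agree Z 0 z); split=> //; first exact: measurable_agree0.
    by rewrite /= indT // mulr1 c0 prob_agree0.
  exists set0; split=> //; first by rewrite measure0 lee_fin mulr_ge0 ?exprn_ge0 ?invr_ge0 ?ind_ge0.
  move=> w _ aw /Qdep Qw; apply: Qz; apply: Qw => p pp pZ; exact: aw.
have kZ' := ltnW kZ; have sz' := signs_flip (pred1 k) sz.
have [B1 [m1 P1 H1]] := IH kZ' z sz; have [B2 [m2 P2 H2]] := IH kZ' _ sz'.
set a := avg k _ z in P1; set b := avg k _ _ in P2.
rewrite /= -/a -/b.
have agreeE w : agree Z k.+1 z w -> forall z', (forall p, p != k -> z' p = z p) ->
    (prime k -> f k w = z' k) -> agree Z k z' w.
  move=> aw z' zz' fk p pp /andP[kp pZ]; have [pk|pk] := eqVneq p k.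
    by rewrite pk; apply: fk; rewrite -pk.
  by rewrite zz' // aw // pZ ltn_neqAle eq_sym pk kp.
have flip_ne p : p != k -> flip (pred1 k) z p = z p by rewrite /flip /= => /negPf ->.
have cE : cnt k = (prime k + cnt k.+1)%N.
  have -> : (prime k : nat) = count (pred1 k) (primes_below Z).
    by rewrite count_uniq_mem ?uniq_primes_below // mem_primes_below kZ andbT.
  rewrite /cnt !size_filter -count_predUI [X in (_ + X)%N](@eq_count _ _ pred0) ?count_pred0 ?addn0.
    by apply: eq_count => p /=; rewrite leq_eqVlt eq_sym.
  by move=> p /=; case: eqP => // ->; rewrite ltnn.
(* At a nonprime [k] the cylinder is the same for both signs, so either cover serves; the one with
   the smaller average is below the mean. *)
have [kp|nkp] := boolP (prime k); last first.
  have c1 : cnt k.+1 = cnt k by rewrite cE (negPf nkp).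
  rewrite c1; have [ab|ba] := leP a b.
    exists B1; split=> //; last first.
      by move=> w sw aw; apply: H1 => //; apply: agreeE aw _ _ _ => // kp; rewrite kp in nkp.
    apply: le_trans P1 _; rewrite lee_fin ler_wpM2l ?exprn_ge0 ?invr_ge0 //; lra.
  exists B2; split=> //; last first.
    by move=> w sw aw; apply: H2 => //; apply: agreeE aw _ _ _ => // kp; rewrite kp in nkp.
  by apply: le_trans P2 _; rewrite lee_fin ler_wpM2l ?exprn_ge0 ?invr_ge0 //; lra.
exists (B1 `|` B2); split; first exact: measurableU.
  apply: le_trans (measureU2 _ m1 m2) _; apply: le_trans (leeD P1 P2) _.
  rewrite -EFinD lee_fin cE kp add1n exprS le_eqVlt; apply/orP; left; apply/eqP.
  by ring.
move=> w sw aw Qw; have [fk|fk] := eqVneq (f k w) (z k).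
  by left; apply: H1 => //; apply: agreeE aw _ _ _.
right; apply: H2 => //; apply: agreeE aw _ _ _ => // _; rewrite /flip /= eqxx.
by move: fk; case: (sw k kp) => ->; case: (sz k) => ->; rewrite ?opprK ?eqxx.
Qed.

Lemma negligible_one_signed x0 :
  P.-negligible [set w | (forall p, prime p -> f p w = 1 \/ f p w = -1) /\
                         forall N, one_signed x0 N (fun p => f p w)].
Proof.
apply: negligible_of_small_covers => eps eps0.
have s1 : signs (fun=> 1 : R) by left.
have [N HN] := avg_one_signed_small x0 s1 eps0.
have [x x' xx'|B [mB PB HB]] := @prob_cover_le_avg N.+1 (one_signed x0 N) _ s1.
  have e n : (n <= N)%N -> msum x n = msum x' n.
    move=> nN; apply: eq_big_nat => k /andP[k0 kn]; rewrite /rmf; case: ifP => // _.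
    apply: eq_big_seq => p; rewrite mem_primes => /and3P[pp _ pk]; apply: xx' => //.
    by rewrite ltnS (leq_trans (dvdn_leq k0 pk)) // (leq_trans _ nN).
  by case=> h; [left | right] => n /andP[n0 nN]; rewrite -e // h // n0.
exists B; split=> //; last by apply: le_trans PB _; rewrite lee_fin.
by move=> w /= [sw os]; exact: HB.
Qed.

End transfer.

Lemma near_pinfty_nat (R : realType) (Q : R -> Prop) :
  (\forall x \near +oo, Q x) -> exists x0 : nat, forall n, (x0 <= n)%N -> Q n%:R.
Proof.
case=> M [_ HM]; exists (Num.truncn M).+1 => n Mn; apply: HM.
by apply: lt_le_trans (truncnS_gt M) _; rewrite ler_nat.
Qed.

Theorem theorem1 (d : measure_display) (T : measurableType d) (R : realType)
    (P : probability T R) (f : nat -> {RV P >-> R}) (hf : rademacher_rmf f) :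
  {ae P, forall w, changes_sign_infinitely_often
                     (fun x : R => summatory (fun n => f n w) x)}.
Proof.
(* The exceptional set is a countable union of null sets: a value at some prime is not a sign, or
   the partial sums keep one sign from some integer [x0] on. *)
pose NS p := [set w | prime p /\ ~ (f p w = 1 \/ f p w = -1)].
pose OS x0 := [set w | (forall p, prime p -> f p w = 1 \/ f p w = -1) /\
                        forall N, one_signed x0 N (fun p => f p w)].
have neg : P.-negligible (\bigcup_p NS p `|` \bigcup_x0 OS x0).
  apply: negligibleU; apply: negligible_bigcup => k; last exact: (negligible_one_signed hf).
  have [kp|nkp] := boolP (prime k).
    by apply: negligibleS (negligible_not_sign hf kp) => w [].
  by apply: negligibleS (negligible_set0 P) => w [kp]; rewrite kp in nkp.
apply: negligibleS neg => w /= Hw.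
have sumE n : summatory (fun n => f n w) (n%:R : R) = msum (fun p => f p w) n.
  rewrite /summatory natrK; apply: eq_big_nat => k /andP[k0 _].
  exact: (rademacher_rmfE hf).
have [sw|nsw] := pselect (forall p, prime p -> f p w = 1 \/ f p w = -1); last first.
  left; move/existsNP: nsw => [p /not_implyP[pp np]].
  by exists p.
right; have [x0 Hx0] : exists x0, forall N, one_signed x0 N (fun p => f p w).
  apply: contrapT => no; apply: Hw; split=> /near_pinfty_nat[x0 Hx0]; apply: no; exists x0 => N.
    by left => n /andP[n0 _]; rewrite -sumE; exact: Hx0.
  by right => n /andP[n0 _]; rewrite -sumE; exact: Hx0.
by exists x0.
Qed.
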